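(* Consider testing $H_0:\boldsymbol\theta=\mathbf 0$ versus $H_1:\boldsymbol\theta\neq\mathbf 0$ where, under $H_1$, $\boldsymbol\theta\mid g,\boldsymbol\gamma_1,\sigma_1^2\sim N_{r_1}(\mathbf 0,g\sigma_1^2\boldsymbol\Omega)$, $\pi_1(\boldsymbol\gamma_1)\propto1$, $\sigma_1^2\sim\text{inv-}\chi^2(s_1^2,\nu_1)$, and $g$ has a prior with density $\pi(g)$ on $(0,\infty)$; and, under $H_0$, $\pi_0(\boldsymbol\gamma_0)\propto 1$ and $\sigma_0^2\sim\text{inv-}\chi^2(s_0^2,\nu_0)$. Let $B_{10}$ be the resulting Bayes factor. (a) If $\nu_0>\nu_1$, then any $\pi(g)$ with positive support yields an information consistent $B_{10}$. (b) If $\nu_0=\nu_1$, then $B_{10}$ is information consistent if and only if $$\int_0^\infty (g+1)^{(n-r_1-r_2+\nu_1)/2}\,\pi(g)\,dg=\infty .$$ (c) If $\nu_0<\nu_1$, then the condition displayed in (b) is necessary for $B_{10}$ to be information consistent.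
   Context: Model: $\mathbf y=\mathbf X_{\boldsymbol\theta}\boldsymbol\theta+\mathbf X_{\boldsymbol\gamma}\boldsymbol\gamma+\boldsymbol\epsilon$, $\boldsymbol\epsilon\sim N(\mathbf 0,\sigma^2\boldsymbol\Sigma)$, with $\mathbf y\in\mathbb R^n$, $\boldsymbol\theta\in\mathbb R^{r_1}$ ($r_1\ge1$) the tested parameters, $\boldsymbol\gamma\in\mathbb R^{r_2}$ ($r_2\ge0$) nuisance parameters, $n>r_1+r_2$, $\boldsymbol\Sigma$ a known positive definite matrix, $[\mathbf X_{\boldsymbol\theta}\ \mathbf X_{\boldsymbol\gamma}]$ of full column rank, and $\mathbf X_{\boldsymbol\theta}'\boldsymbol\Sigma^{-1}\mathbf X_{\boldsymbol\gamma}=\mathbf 0$. Let $\mathcal I=\mathbf X_{\boldsymbol\theta}'\boldsymbol\Sigma^{-1}\mathbf X_{\boldsymbol\theta}$, $\hat{\boldsymbol\theta}=\mathcal I^{-1}\mathbf X_{\boldsymbol\theta}'\boldsymbol\Sigma^{-1}\mathbf y$ (the ML estimate), and let $s_{\mathbf y}^2=(\mathbf y-\mathbf X_{\boldsymbol\theta}\hat{\boldsymbol\theta}-\mathbf X_{\boldsymbol\gamma}\hat{\boldsymbol\gamma})'\boldsymbol\Sigma^{-1}(\mathbf y-\mathbf X_{\boldsymbol\theta}\hat{\boldsymbol\theta}-\mathbf X_{\boldsymbol\gamma}\hat{\boldsymbol\gamma})$. $\boldsymbol\Omega$ is a fixed positive definite $r_1\times r_1$ matrix, $\nu_t\ge 0$,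 $s_t>0$; $\text{inv-}\chi^2(s^2,\nu)$ has density proportional to $(\sigma^2)^{-\nu/2-1}e^{-\nu s^2/(2\sigma^2)}$, with $\nu=0$ denoting the improper prior $\sigma^{-2}$. $\pi(g)$ is a probability density supported on positive values of $g$. The Bayes factor (ratio of marginal likelihoods) is $B_{10}=\int_0^\infty B_{10}(g)\pi(g)\,dg$, where $$B_{10}(g)=C_1(g)\frac{\left(s_1^2\nu_1+s_{\mathbf y}^2+\hat{\boldsymbol\theta}'(\mathcal I^{-1}+g\boldsymbol\Omega)^{-1}\hat{\boldsymbol\theta}\right)^{-(n+\nu_1-r_2)/2}}{\left(s_0^2\nu_0+s_{\mathbf y}^2+\hat{\boldsymbol\theta}'\mathcal I\hat{\boldsymbol\theta}\right)^{-(n+\nu_0-r_2)/2}},\qquad C_1(g)=\frac{\kappa_1\Gamma(\frac{n+\nu_1-r_2}{2})}{\kappa_0\Gamma(\frac{n+\nu_0-r_2}{2})}2^{(\nu_1-\nu_0)/2}|g\boldsymbol\Omega+\mathcal I^{-1}|^{-1/2}|\mathcal I|^{-1/2},$$ with $\kappa_t=(\nu_t/2)^{\nu_t/2}s_t^{\nu_t}/\Gamma(\nu_t/2)$ if $\nu_t>0$ and $\kappa_t=1$ if $\nu_t=0$. Definition: $B_{10}$ is information inconsistent if there exists a sequence of possible data with corresponding $|\hat{\boldsymbol\theta}_i|\to\infty$ as $i\to\infty$ along which $B_{10}<B_{10}^*$ for some constant $B_{10}^*<\infty$; otherwise (i.e. $B_{10}\to\infty$ whenever $|\hat{\boldsymbol\theta}|\to\infty$)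 it is information consistent. All other quantities ($n$, design, $\boldsymbol\Sigma$, hyperparameters, $s_{\mathbf y}^2>0$) are held fixed along the sequence. *)

(* Defs.v *)
From HB Require Import structures.
From mathcomp Require Import all_boot all_order all_algebra.
From mathcomp Require Import all_classical all_reals all_analysis.
Import Order.TTheory GRing.Theory Num.Theory.
Import numFieldNormedType.Exports.

Set Implicit Arguments.
Unset Strict Implicit.
Unset Printing Implicit Defensive.

Local Open Scope classical_set_scope.
Local Open Scope ring_scope.

(* Data and parameters are column vectors. *)

Definition qform (R : realType) (k : nat) (A : 'M[R]_k) (x : 'cV[R]_k) : R :=
  (x^T *m A *m x) 0 0.

Definition posdefmx (R : realType) (k : nat) (A : 'M[R]_k) : Prop :=
  A^T = A /\ forall x : 'cV[R]_k, x != 0 -> 0 < qform A x.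

(* The library norm on matrices is the sup norm; this is the Euclidean one. *)
Definition enorm (R : realType) (k : nat) (x : 'cV[R]_k) : R :=
  Num.sqrt ((x^T *m x) 0 0).

(* Lebesgue integral over R^k, one coordinate at a time. It is only applied to
   nonnegative Borel functions, for which, by Tonelli, it is the integral
   against the k-dimensional Lebesgue measure. *)
Fixpoint integral_cV (R : realType) (k : nat) : ('cV[R]_k -> \bar R) -> \bar R :=
  match k with
  | 0%N => fun f => f 0
  | k'.+1 => fun f =>
      (\int[lebesgue_measure]_t
         integral_cV (fun v : 'cV[R]_k' => f (col_mx (t%:M : 'cV_1) v)))%E
  end.

Definition gamma_fun (R : realType) (a : R) : R :=
  \int[lebesgue_measure]_(x in `]0%R, +oo[) (x `^ (a - 1) * expR (- x)).

Definition mvnormal_pdf (R : realType) (k : nat)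
    (m : 'cV[R]_k) (V : 'M[R]_k) (x : 'cV[R]_k) : R :=
  (Num.sqrt ((2 * pi) ^+ k * \det V))^-1
  * expR (- (qform (invmx V) (x - m) / 2)).

(* Normalizing constant of inv-chi^2(s^2, nu); when nu = 0 the prior is the
   improper (sigma^2)^-1. *)
Definition inv_chi2_cst (R : realType) (s nu : R) : R :=
  if nu == 0 then 1
  else (nu / 2) `^ (nu / 2) * s `^ nu / gamma_fun (nu / 2).

(* Density of inv-chi^2(s^2, nu) as a function of the variance v = sigma^2. *)
Definition inv_chi2_pdf (R : realType) (s nu v : R) : R :=
  inv_chi2_cst s nu * v `^ (- (nu / 2) - 1) * expR (- (nu * s ^+ 2 / (2 * v))).

Definition is_pos_density (R : realType) (p : R -> R) : Prop :=
  [/\ measurable_fun (`]0, +oo[ : set R) p,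
      forall g, 0 < g -> 0 <= p g
    & (\int[lebesgue_measure]_(g in `]0%R, +oo[) (p g)%:E = 1)%E].

Section LinearModel.
Variables (R : realType) (n r1 r2 : nat).
Variables (Xt : 'M[R]_(n, r1)) (Xg : 'M[R]_(n, r2)) (Sigma : 'M[R]_n).

(* Generalized least squares = maximum likelihood estimate for the design X;
   since Xt^T Sigma^-1 Xg = 0, the joint estimate of (theta, gamma) is obtained
   by taking X := Xt and X := Xg separately. *)
Definition gls (r : nat) (X : 'M[R]_(n, r)) (y : 'cV[R]_n) : 'cV[R]_r :=
  invmx (X^T *m invmx Sigma *m X) *m X^T *m invmx Sigma *m y.

Definition theta_hat (y : 'cV[R]_n) : 'cV[R]_r1 := gls Xt y.
Definition gamma_hat (y : 'cV[R]_n) : 'cV[R]_r2 := gls Xg y.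

Definition s2_resid (y : 'cV[R]_n) : R :=
  qform (invmx Sigma) (y - Xt *m theta_hat y - Xg *m gamma_hat y).

Definition likelihood (y : 'cV[R]_n)
    (th : 'cV[R]_r1) (ga : 'cV[R]_r2) (v : R) : R :=
  mvnormal_pdf (Xt *m th + Xg *m ga) (v *: Sigma) y.

Definition marginal0 (s0 nu0 : R) (y : 'cV[R]_n) : \bar R :=
  (\int[lebesgue_measure]_(v in `]0%R, +oo[)
     integral_cV (fun ga : 'cV[R]_r2 =>
       (likelihood y 0 ga v * inv_chi2_pdf s0 nu0 v)%:E))%E.

Definition marginal1_given (Omega : 'M[R]_r1) (s1 nu1 : R) (g : R)
    (y : 'cV[R]_n) : \bar R :=
  (\int[lebesgue_measure]_(v in `]0%R, +oo[)
     integral_cV (fun th : 'cV[R]_r1 =>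
       integral_cV (fun ga : 'cV[R]_r2 =>
         (likelihood y th ga v * mvnormal_pdf 0 ((g * v) *: Omega) th
          * inv_chi2_pdf s1 nu1 v)%:E)))%E.

Definition marginal1 (Omega : 'M[R]_r1) (s1 nu1 : R) (prior : R -> R)
    (y : 'cV[R]_n) : \bar R :=
  (\int[lebesgue_measure]_(g in `]0%R, +oo[)
     (marginal1_given Omega s1 nu1 g y * (prior g)%:E))%E.

Definition bayes_factor (Omega : 'M[R]_r1) (s0 nu0 s1 nu1 : R)
    (prior : R -> R) (y : 'cV[R]_n) : \bar R :=
  (marginal1 Omega s1 nu1 prior y / marginal0 s0 nu0 y)%E.

(* s2 is the value at which the residual sum of squares is held fixed along the
   sequence of data. *)
Definition information_inconsistent (s2 : R) (B : 'cV[R]_n -> \bar R) : Prop :=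
  exists (y : nat -> 'cV[R]_n) (Bstar : R),
    [/\ forall i, s2_resid (y i) = s2,
        enorm (theta_hat (y i)) @[i --> \oo] --> +oo
      & forall i, (B (y i) < Bstar%:E)%E].

Definition information_consistent (s2 : R) (B : 'cV[R]_n -> \bar R) : Prop :=
  ~ information_inconsistent s2 B.

End LinearModel.

(* Main.v *)
Require Import Defs.
From mathcomp Require Import all_boot all_order all_algebra.
From mathcomp Require Import all_classical all_reals all_analysis.
From mathcomp Require Import measurable_realfun.
From mathcomp Require Import ring lra.
Import Order.TTheory GRing.Theory Num.Theory.
Import numFieldNormedType.Exports.
Local Open Scope classical_set_scope.
Local Open Scope ring_scope.
Set Implicit Arguments.
Unset Strict Implicit.
Unset Printing Implicit Defensive.

(** Only the growth of the Bayes factor matters, so every integral is estimated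
    up to multiplicative constants instead of being computed. Write [t] for the
    squared Euclidean norm of the estimate of theta, [p0] and [p1] for
    [(n - r2 + nu0) / 2] and [(n - r2 + nu1) / 2].

    Since a positive definite form lies between two multiples of the squared
    norm ([posdef_equiv_sqn]), the Gaussian integrals over gamma and theta reduce
    to isotropic ones, and the remaining integral over the variance is an inverse
    Gamma integral, of order [B `^ (- p)] in its scale [B]
    ([integral_inv_gamma_kernel]). With the residual sum of squares held fixed
    this gives, up to constants, [(1 + t) `^ (- p0)] for the marginal likelihood
    under the null hypothesis ([marginal0_bounds]) and
      [(1 + g) `^ (p1 - r1 / 2) * (1 + g + t) `^ (- p1)]
    for the alternative given [g] ([marginal1_bounds]). The exponent
    [p1 - r1 / 2] is the one of the moment in the theorem.

    As [1 + g + t] is at least [1 + t], and at most twice that when [g <= t], the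
    Bayes factor is at most a multiple of [(1 + t) `^ (p0 - p1)] times the moment
    of the prior ([bayes_factor_le]) and at least a multiple of
    [(1 + t) `^ (p0 - p1)] times that moment truncated at any level below [t]
    ([bayes_factor_ge]).

    If [nu0 <= nu1] and the moment is finite, the upper bound stays bounded along
    every sequence of such data; sequences with a fixed residual and a diverging
    estimate exist because [r1 + r2 < n] ([data_with_estimate]). Conversely, a
    Bayes factor bounded along such a sequence bounds every truncated moment, hence
    the moment itself when [nu0 = nu1]; when [nu1 < nu0] the factor
    [(1 + t) `^ (p0 - p1)] diverges and makes the truncated moments arbitrarily small,
    which a probability density forbids. *)

(** * Quadratic forms *)

Section QuadraticForms.
Variables (R : realType) (k : nat).
Implicit Types (A : 'M[R]_k) (x y : 'cV[R]_k).

Definition sqn x : R := (x^T *m x) 0 0.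

Definition bform A x y : R := (x^T *m A *m y) 0 0.

Lemma sqnE x : sqn x = \sum_i x i 0 ^+ 2.
Proof. by rewrite /sqn mxE; apply: eq_bigr => i _; rewrite mxE expr2. Qed.

Lemma sqn_ge0 x : 0 <= sqn x.
Proof. by rewrite sqnE sumr_ge0// => i _; exact: sqr_ge0. Qed.

Lemma sqn_eq0 x : (sqn x == 0) = (x == 0).
Proof.
apply/eqP/eqP => [|->]; last by rewrite /sqn mulmx0 mxE.
rewrite sqnE => /eqP; rewrite psumr_eq0; last by move=> i _; exact: sqr_ge0.
move=> /allP x0; apply/matrixP => i j; rewrite (ord1 j) mxE.
by apply/eqP; rewrite -sqrf_eq0; apply: (x0 i); rewrite mem_index_enum.
Qed.

Lemma sqn_gt0 x : x != 0 -> 0 < sqn x.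
Proof. by move=> x0; rewrite lt_neqAle sqn_ge0 eq_sym sqn_eq0 x0. Qed.

Lemma sqr_enorm x : enorm x ^+ 2 = sqn x.
Proof. by rewrite sqr_sqrtr// sqn_ge0. Qed.

Lemma qformZ A (a : R) x : qform A (a *: x) = a ^+ 2 * qform A x.
Proof.
by rewrite /qform [_^T]linearZ /= -scalemxAr -!scalemxAl !mxE expr2 mulrA.
Qed.

Lemma qformN A x : qform A (- x) = qform A x.
Proof. by rewrite -scaleN1r qformZ sqrrN expr1n mul1r. Qed.

Lemma qform_scale (a : R) A x : qform (a *: A) x = a * qform A x.
Proof. by rewrite /qform -scalemxAr -scalemxAl mxE. Qed.

Lemma bform_sym A x y : A^T = A -> bform A y x = bform A x y.
Proof.
move=> As; have -> : bform A y x = (y^T *m A *m x)^T 0 0 by rewrite mxE.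
by rewrite !trmx_mul trmxK As mulmxA.
Qed.

Lemma qformD A x y : A^T = A ->
  qform A (x + y) = qform A x + 2 * bform A x y + qform A y.
Proof.
move=> As; rewrite /qform [_^T]linearD /= !mulmxDl !mulmxDr.
rewrite ![fun_of_matrix (_ + _) _ _]mxE -/(bform A x y) -/(bform A y x) (bform_sym x y As).
by rewrite mulr_natl mulr2n !addrA.
Qed.

Lemma posdef_qform_ge0 A x : posdefmx A -> 0 <= qform A x.
Proof.
move=> [_ A0]; have [->|/A0/ltW//] := eqVneq x 0.
by rewrite /qform mulmx0 mxE.
Qed.

(** Nonnegativity of the form at [qform A y *: x - bform A x y *: y]. *)
Lemma bform_CauchySchwarz A x y : posdefmx A ->
  bform A x y ^+ 2 <= qform A x * qform A y.
Proof.
move=> Ap; have [As A0] := Ap.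
have [->|y0] := eqVneq y 0.
  by rewrite /bform /qform !mulmx0 !mxE expr0n mulr0.
have Ay := A0 _ y0.
have := posdef_qform_ge0 (qform A y *: x - bform A x y *: y) Ap.
rewrite qformD// qformN !qformZ.
have -> : bform A (qform A y *: x) (- (bform A x y *: y)) =
    - (qform A y * bform A x y ^+ 2).
  rewrite {1}/bform linearZ /= mulmxN -scalemxAr -!scalemxAl.
  rewrite [LHS]mxE ![fun_of_matrix (_ *: _) _ _]mxE -/(bform A x y); ring.
move=> h; have {h} : 0 <= qform A y * (qform A x * qform A y - bform A x y ^+ 2).
  by apply: le_trans h _; rewrite le_eqVlt; apply/orP; left; apply/eqP; ring.
by rewrite pmulr_rge0// subr_ge0.
Qed.

Lemma qform_ub A : exists2 C : R, 0 < C & forall x, qform A x <= C * sqn x.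
Proof.
exists (1 + \sum_i \sum_j `|A i j|).
  by rewrite ltr_wpDr// sumr_ge0// => i _; rewrite sumr_ge0.
move=> x; rewrite mulrDl mul1r ler_wpDl ?sqn_ge0//.
rewrite /qform mxE mulr_suml.
have -> : \sum_j (x^T *m A) 0 j * x j 0 = \sum_i \sum_j x i 0 * A i j * x j 0.
  rewrite exchange_big /=; apply: eq_bigr => j _; rewrite mxE mulr_suml.
  by apply: eq_bigr => i _; rewrite mxE.
rewrite ler_sum// => i _; rewrite mulr_suml ler_sum// => j _.
apply: (le_trans (ler_norm _)); rewrite !normrM.
rewrite [`|x i 0| * _]mulrC -mulrA ler_wpM2l//.
have hs (i' : 'I_k) : `|x i' 0| ^+ 2 <= sqn x.
  rewrite sqnE (bigD1 i')//= real_normK ?num_real// lerDl sumr_ge0// => ? _.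
  exact: sqr_ge0.
have := hs i; have := hs j; have := sqr_ge0 (`|x i 0| - `|x j 0|).
by nra.
Qed.

Lemma posdef_scale (a : R) A : 0 < a -> posdefmx A -> posdefmx (a *: A).
Proof.
move=> a0 [As A0]; split; first by rewrite linearZ /= As.
by move=> x x0; rewrite qform_scale mulr_gt0 ?A0.
Qed.

Lemma posdef_inj A x : posdefmx A -> A *m x = 0 -> x = 0.
Proof.
move=> [_ A0] Ax; apply/eqP/negPn/negP => /A0.
by rewrite /qform -mulmxA Ax mulmx0 mxE ltxx.
Qed.

Lemma posdef_unitmx A : posdefmx A -> A \in unitmx.
Proof.
move=> Ap; rewrite -unitmx_tr -row_free_unit -kermx_eq0.
apply/eqP/row_matrixP => i; rewrite row0; apply: trmx_inj; rewrite trmx0.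
apply: (posdef_inj Ap); set u := row i _.
have -> : A *m u^T = (u *m A^T)^T by rewrite trmx_mul trmxK.
by rewrite -row_mul mulmx_ker row0 trmx0.
Qed.

Lemma posdef_inv A : posdefmx A -> posdefmx (invmx A).
Proof.
move=> Ap; have [As A0] := Ap; have Au := posdef_unitmx Ap.
have Vs : (invmx A)^T = invmx A by rewrite trmx_inv As.
split=> // x x0; have -> : qform (invmx A) x = qform A (invmx A *m x).
  by rewrite /qform trmx_mul Vs -!mulmxA (mulKVmx Au).
apply: A0; apply: contra x0 => /eqP h.
by rewrite -(mulKVmx Au x) h mulmx0.
Qed.

(** On the segment from the identity to [A] all matrices are positive definite,
    hence invertible; the determinant, a polynomial in the parameter which
    starts at [1], cannot change sign. *)
Lemma posdef_det_gt0 A : posdefmx A -> 0 < \det A.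
Proof.
move=> [As A0].
pose P : 'M[{poly R}]_k := 'X *: map_mx polyC A + (1 - 'X)%:M.
have PE t : (\det P).[t] = \det (t *: A + (1 - t)%:M).
  rewrite -[LHS]/(horner_eval t (\det P)) -det_map_mx; congr (\det _).
  apply/matrixP => i j; rewrite !mxE /= /horner_eval hornerD hornerM.
  by rewrite hornerX hornerC hornerMn !hornerE.
have P1 : (\det P).[1] = \det A.
  by rewrite PE scale1r subrr raddf0 addr0.
have P0 : (\det P).[0] = 1 by rewrite PE scale0r add0r subr0 det1.
have nroot t : 0 <= t <= 1 -> (\det P).[t] != 0.
  move=> /andP[t0 t1]; rewrite PE -unitfE -unitmxE; apply: posdef_unitmx.
  split=> [|x x0]; first by rewrite linearD linearZ /= As tr_scalar_mx.
  have -> : qform (t *: A + (1 - t)%:M) x = t * qform A x + (1 - t) * sqn x.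
    rewrite /qform mulmxDr mulmxDl -scalemxAr mul_mx_scalar -!scalemxAl.
    by rewrite [LHS]mxE ![fun_of_matrix (_ *: _) _ _]mxE.
  by have := A0 _ x0; have := sqn_gt0 x0; nra.
rewrite -P1 ltNge; apply/negP => P1le.
have [|t /andP[t0 t1]] := @poly_ivt R (- \det P) 0 1 ler01.
  by rewrite !hornerN P0 oppr_le0 ler01 oppr_ge0.
by rewrite rootN rootE; apply/negP/nroot; rewrite t0.
Qed.

(** For the lower bound: by Cauchy-Schwarz for the form,
    [sqn (A *m x) ^+ 2 <= qform A (A *m x) * qform A x], so [sqn (A *m x)] is at
    most a multiple of [qform A x]; and [x] is the image of [A *m x] under the
    inverse of [A]. *)
Lemma posdef_equiv_sqn A : posdefmx A ->
  exists c C : R, [/\ 0 < c, 0 < C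
    & forall x, c * sqn x <= qform A x <= C * sqn x].
Proof.
move=> Ap; have Au := posdef_unitmx Ap.
have [C C0 hC] := qform_ub A.
have [D D0 hD] := qform_ub ((invmx A)^T *m invmx A).
exists (C * D)^-1, C; split=> //; first by rewrite invr_gt0 mulr_gt0.
move=> x; rewrite hC andbT mulrC ler_pdivrMr ?mulr_gt0//.
have h1 : sqn x <= D * sqn (A *m x).
  apply: le_trans (hD _); rewrite -{1}(mulKmx Au x).
  by rewrite /qform /sqn trmx_mul !mulmxA.
have h2 : sqn (A *m x) <= C * qform A x.
  have [->|Ax0] := eqVneq (sqn (A *m x)) 0.
    by rewrite mulr_ge0 ?(ltW C0) ?posdef_qform_ge0.
  have Ax : 0 < sqn (A *m x) by rewrite lt_neqAle eq_sym Ax0 sqn_ge0.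
  have /= CS := bform_CauchySchwarz (A *m x) x Ap.
  have E : bform A (A *m x) x = sqn (A *m x) by rewrite /sqn /bform mulmxA.
  rewrite -(ler_pM2l Ax) -expr2 -{1}E; apply: (le_trans CS).
  by rewrite mulrA [sqn _ * C]mulrC ler_wpM2r ?posdef_qform_ge0.
apply: (le_trans h1); rewrite [qform A x * _]mulrC [C * D]mulrC -mulrA.
by rewrite ler_wpM2l ?(ltW D0).
Qed.

End QuadraticForms.

(** * Generalized least squares *)

Section GramMatrices.
Variables (R : realType) (n r : nat).
Variables (W : 'M[R]_n) (X : 'M[R]_(n, r)).

Lemma qform_gram (u : 'cV[R]_r) :
  qform (X^T *m W *m X) u = qform W (X *m u).
Proof. by rewrite /qform trmx_mul !mulmxA. Qed.

Lemma posdef_gram : posdefmx W -> (forall u : 'cV_r, X *m u = 0 -> u = 0) ->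
  posdefmx (X^T *m W *m X).
Proof.
move=> [Ws W0] Xinj; split=> [|u u0].
  by rewrite !trmx_mul trmxK Ws mulmxA.
by rewrite qform_gram; apply: W0; apply: contra u0 => /eqP /Xinj ->.
Qed.

End GramMatrices.

Section LeastSquares.
Variables (R : realType) (n r1 r2 : nat).
Variables (Xt : 'M[R]_(n, r1)) (Xg : 'M[R]_(n, r2)) (Sigma : 'M[R]_n).
Hypotheses (hSigma : posdefmx Sigma)
  (hrank : \rank (row_mx Xt Xg) = (r1 + r2)%N)
  (horth : Xt^T *m invmx Sigma *m Xg = 0).

Local Notation W := (invmx Sigma).
Local Notation I := (Xt^T *m W *m Xt).
Local Notation J := (Xg^T *m W *m Xg).
Local Notation th_hat := (theta_hat Xt Sigma).
Local Notation ga_hat := (gamma_hat Xg Sigma).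

Lemma design_inj (a : 'cV[R]_r1) (b : 'cV[R]_r2) :
  Xt *m a + Xg *m b = 0 -> a = 0 /\ b = 0.
Proof.
rewrite -mul_row_col => ab0.
have Mfree : row_free (row_mx Xt Xg)^T by rewrite /row_free mxrank_tr hrank.
have : (col_mx a b)^T *m (row_mx Xt Xg)^T = 0 by rewrite -trmx_mul ab0 trmx0.
move/eqP; rewrite mulmx_free_eq0// -trmx0 => /eqP /trmx_inj.
by rewrite -(col_mx0 R r1 r2 1) => /eq_col_mx.
Qed.

Lemma posdef_I : posdefmx I.
Proof.
apply: posdef_gram; first exact: posdef_inv.
by move=> u Xu; apply: (proj1 (@design_inj u 0 _)); rewrite Xu mulmx0 addr0.
Qed.

Lemma posdef_J : posdefmx J.
Proof.
apply: posdef_gram; first exact: posdef_inv.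
by move=> u Xu; apply: (proj2 (@design_inj 0 u _)); rewrite Xu mulmx0 addr0.
Qed.

Let Ws : W^T = W. Proof. exact: (posdef_inv hSigma).1. Qed.

Let horth' : Xg^T *m W *m Xt = 0.
Proof.
by apply: trmx_inj; rewrite trmx0 -horth !trmx_mul trmxK Ws mulmxA.
Qed.

Let e y := y - Xt *m th_hat y - Xg *m ga_hat y.

Lemma glsE r (X : 'M[R]_(n, r)) (y : 'cV[R]_n) :
  gls Sigma X y = invmx (X^T *m W *m X) *m (X^T *m W *m y).
Proof. by rewrite /gls !mulmxA. Qed.

Lemma gls_normal r (X : 'M[R]_(n, r)) (y : 'cV[R]_n) :
  X^T *m W *m X \in unitmx -> X^T *m W *m (X *m gls Sigma X y) = X^T *m W *m y.
Proof. by move=> Xu; rewrite glsE [LHS]mulmxA mulKVmx. Qed.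

Lemma gls_fit r (X : 'M[R]_(n, r)) (a : 'cV[R]_r) (u : 'cV[R]_n) :
  X^T *m W *m X \in unitmx -> X^T *m W *m u = 0 -> gls Sigma X (X *m a + u) = a.
Proof.
by move=> Xu u0; rewrite glsE mulmxDr u0 addr0 [_ *m (X *m a)]mulmxA mulKmx.
Qed.

Let e_orth_t y : Xt^T *m W *m e y = 0.
Proof.
rewrite /e !mulmxBr /theta_hat gls_normal ?(posdef_unitmx posdef_I)//.
by rewrite mulmxA horth mul0mx subrr subr0.
Qed.

Let e_orth_g y : Xg^T *m W *m e y = 0.
Proof.
rewrite /e !mulmxBr /gamma_hat gls_normal ?(posdef_unitmx posdef_J)//.
by rewrite [_ *m (Xt *m _)]mulmxA horth' mul0mx subr0 subrr.
Qed.

(** Pythagoras: for the inner product of [invmx Sigma] the residual is orthogonal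
    to both designs, and these are orthogonal to each other. *)
Lemma rss_decomposition y (th : 'cV[R]_r1) (ga : 'cV[R]_r2) :
  qform W (y - (Xt *m th + Xg *m ga)) =
  s2_resid Xt Xg Sigma y + qform I (th - th_hat y) + qform J (ga - ga_hat y).
Proof.
have -> : y - (Xt *m th + Xg *m ga) =
    e y - (Xt *m (th - th_hat y) + Xg *m (ga - ga_hat y)).
  rewrite /e !mulmxBr; move: (Xt *m th) (Xg *m ga) => a b.
  move: (Xt *m th_hat y) (Xg *m ga_hat y) => c d.
  by apply/matrixP => i j; rewrite !mxE; ring.
set a := th - _; set b := ga - _.
rewrite (qformD (e y) (- _) Ws) qformN (qformD (Xt *m a) _ Ws) !qform_gram.
rewrite -[s2_resid _ _ _ _]/(qform W (e y)).
have -> : bform W (e y) (- (Xt *m a + Xg *m b)) = 0.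
  have et : (e y)^T *m W *m Xt = 0.
    by apply: trmx_inj; rewrite !trmx_mul trmxK Ws mulmxA e_orth_t trmx0.
  have eg : (e y)^T *m W *m Xg = 0.
    by apply: trmx_inj; rewrite !trmx_mul trmxK Ws mulmxA e_orth_g trmx0.
  by rewrite /bform mulmxN mulmxDr !mulmxA et eg !mul0mx addr0 oppr0 mxE.
have -> : bform W (Xt *m a) (Xg *m b) = 0.
  rewrite /bform trmx_mul -!mulmxA [W *m _]mulmxA [Xt^T *m _]mulmxA.
  by rewrite [Xt^T *m (_ *m _)]mulmxA horth mul0mx mulmx0 mxE.
by rewrite !mulr0 !addr0 addrA.
Qed.

(** As [r1 + r2 < n], some nonzero vector is orthogonal to both designs; scaled so
    that its form is [s2], it serves as the residual, and [Xt *m a] can be added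
    to it freely. *)
Lemma data_with_estimate (s2 : R) (a : 'cV[R]_r1) : (r1 + r2 < n)%N -> 0 < s2 ->
  exists2 y, th_hat y = a & s2_resid Xt Xg Sigma y = s2.
Proof.
move=> hn s20; pose M := W *m row_mx Xt Xg.
have : kermx M != 0.
  rewrite -mxrank_eq0 mxrank_ker subn_eq0 -ltnNge.
  by apply: leq_ltn_trans hn; exact: rank_leq_col.
move=> /rowV0Pn[v /sub_kermxP vM v0].
have uW : (row_mx Xt Xg)^T *m W *m v^T = 0.
  by rewrite -[X in _ *m X *m _]Ws -!trmx_mul vM trmx0.
have u0 : v^T != 0 by rewrite trmx_eq0.
have q0 : 0 < qform W v^T by apply: (posdef_inv hSigma).2.
pose u := Num.sqrt (s2 / qform W v^T) *: v^T.
have uE : qform W u = s2.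
  rewrite qformZ sqr_sqrtr ?divrK ?unitfE ?gt_eqF//.
  by rewrite divr_ge0 ?ltW.
move: uW; rewrite tr_row_mx !mul_col_mx -[RHS](col_mx0 R r1 r2 1).
move=> /eq_col_mx[ut ug].
have {}ut : Xt^T *m W *m u = 0 by rewrite -scalemxAr ut scaler0.
have {}ug : Xg^T *m W *m u = 0 by rewrite -scalemxAr ug scaler0.
have thE : th_hat (Xt *m a + u) = a.
  by rewrite /theta_hat gls_fit// (posdef_unitmx posdef_I).
exists (Xt *m a + u) => //.
have gaE : ga_hat (Xt *m a + u) = 0.
  rewrite /gamma_hat glsE mulmxDr ug addr0.
  by rewrite [_ *m (Xt *m a)]mulmxA horth' mul0mx mulmx0.
by rewrite /s2_resid thE gaE mulmx0 subr0 addrAC subrr add0r.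
Qed.

End LeastSquares.

(** * Integrals of nonnegative functions and Gaussian integrals over R^k *)

Section NonnegativeIntegrals.
Local Open Scope ereal_scope.
Context d (T : measurableType d) (R : realType).
Variable mu : {measure set T -> \bar R}.

(** The integral of a nonnegative function is a supremum over the simple
    functions below it, so monotonicity requires no measurability. *)
Lemma le_ge0_integral (D : set T) (f g : T -> \bar R) :
  (forall x, D x -> 0 <= f x) -> (forall x, D x -> f x <= g x) ->
  \int[mu]_(x in D) f x <= \int[mu]_(x in D) g x.
Proof.
move=> f0 fg; have g0 x : D x -> 0 <= g x.
  by move=> Dx; apply: le_trans (f0 _ Dx) (fg _ Dx).
rewrite !ge0_integralE//; apply: ereal_sup_le => _ /= [h hf <-].
exists h => // x; apply: le_trans (hf x) _.
by apply: lee_restrict.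
Qed.

(** Monotone convergence, used to reduce the open half-line to intervals. *)
Lemma integral_le_of_exhaustion (F : (set T)^nat) (f : T -> \bar R) (M : \bar R) :
  nondecreasing_seq F -> (forall i, measurable (F i)) ->
  (forall i, measurable_fun (F i) f) -> (forall i x, F i x -> 0 <= f x) ->
  (forall i, \int[mu]_(x in F i) f x <= M) ->
  \int[mu]_(x in \bigcup_i F i) f x <= M.
Proof.
move=> ndF mF mf f0 FM.
have /(_ mu) cF := ge0_nondecreasing_set_cvg_integral ndF mF mf f0.
rewrite -(cvg_lim _ cF)//; apply: lime_le; first by apply/cvg_ex; eexists; exact: cF.
by near=> n; exact: FM.
Unshelve. all: by end_near. Qed.

End NonnegativeIntegrals.

Section IntegralOverRk.
Variable R : realType.
Local Open Scope ereal_scope.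

Lemma integral_cV_ge0 k (f : 'cV[R]_k -> \bar R) :
  (forall x, 0 <= f x) -> 0 <= integral_cV f.
Proof.
elim: k f => [|k IH] f f0 /=; first exact: f0.
by apply: integral_ge0 => t _; apply: IH.
Qed.

Lemma le_integral_cV k (f g : 'cV[R]_k -> \bar R) :
  (forall x, 0 <= f x) -> (forall x, f x <= g x) ->
  integral_cV f <= integral_cV g.
Proof.
elim: k f g => [|k IH] f g f0 fg /=; first exact: fg.
apply: le_ge0_integral => t _; first exact: integral_cV_ge0.
exact: IH.
Qed.

Lemma eq_integral_cV k (f g : 'cV[R]_k -> \bar R) :
  f =1 g -> integral_cV f = integral_cV g.
Proof. by move=> /funext ->. Qed.

Lemma integral_gauss (a m : R) : (0 < a)%R ->
  \int[lebesgue_measure]_t (expR (- (a * (t - m) ^+ 2)))%:E = ((pi / a) `^ 2^-1)%:E.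
Proof.
move=> a0; pose s : R := Num.sqrt (2 * a)^-1.
have a20 : (0 < 2 * a)%R by rewrite mulr_gt0.
have s0 : s != 0%R by rewrite gt_eqF// sqrtr_gt0 invr_gt0.
have s2 : (s ^+ 2 = (2 * a)^-1)%R by rewrite sqr_sqrtr// ltW// invr_gt0.
have -> : (fun t => (expR (- (a * (t - m) ^+ 2)))%:E) =
    (fun t => (normal_peak s)^-1%:E * (normal_pdf m s t)%:E).
  apply/funext => t; rewrite normal_pdfE// -EFinM mulKf; last first.
    by rewrite gt_eqF// normal_peak_gt0.
  by rewrite /normal_fun s2; congr (expR _)%:E; field; rewrite gt_eqF.
rewrite ge0_integralZl_EFin//=; last 3 first.
- by move=> t _; rewrite lee_fin normal_pdf_ge0.
- apply/measurable_EFinP; exact: measurable_normal_pdf.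
- by rewrite invr_ge0 normal_peak_ge0.
rewrite integral_normal_pdf mule1 /normal_peak invrK powR12_sqrt; last first.
  by rewrite divr_ge0 ?pi_ge0 ?ltW.
by rewrite s2; congr (Num.sqrt _)%:E; field; rewrite gt_eqF.
Qed.

Lemma sqn_sub_col_mx k (t t' : R) (v v' : 'cV[R]_k) :
  (sqn (col_mx (t%:M : 'cV_1) v - col_mx (t'%:M : 'cV_1) v') =
   (t - t') ^+ 2 + sqn (v - v'))%R.
Proof.
rewrite opp_col_mx add_col_mx /sqn tr_col_mx mul_row_col mxE; congr +%R.
by rewrite mxE big_ord1 !mxE eqxx !mulr1n expr2.
Qed.

(** Coordinates are integrated one at a time; the constant [K] is general because
    it collects the factor of the first coordinate in the induction. *)
Lemma integral_cV_gauss k (K a : R) (m : 'cV[R]_k) : (0 <= K)%R -> (0 < a)%R ->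
  integral_cV (fun x => (K * expR (- (a * sqn (x - m))))%:E) =
  (K * (pi / a) `^ (k%:R / 2))%:E.
Proof.
move=> K0 a0; elim: k K m K0 => [|k IH] K m K0 /=.
  by rewrite sqnE big_ord0 mulr0 oppr0 expR0 mul0r powRr0.
pose m0 : R := m ord0 ord0; pose m' : 'cV[R]_k := dsubmx (m : 'cV_(1 + k)).
have mE : m = col_mx (m0%:M : 'cV_1) m'.
  have <- : usubmx (m : 'cV_(1 + k)) = m0%:M.
    apply/matrixP => i j; rewrite !ord1 !mxE /= mulr1n; congr (m _ _).
    exact/val_inj.
  by rewrite vsubmxK.
have E t (v : 'cV[R]_k) : (K * expR (- (a * sqn (col_mx (t%:M : 'cV_1) v - m))) =
   K * expR (- (a * (t - m0) ^+ 2)) * expR (- (a * sqn (v - m'))))%R.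
  have -> : sqn (col_mx (t%:M : 'cV_1) v - m) = ((t - m0) ^+ 2 + sqn (v - m'))%R.
    by rewrite mE -sqn_sub_col_mx.
  by rewrite mulrDr opprD expRD mulrA.
under eq_integral => t _.
  under eq_integral_cV do rewrite E.
  rewrite IH ?mulr_ge0 ?expR_ge0// mulrAC EFinM.
  over.
rewrite ge0_integralZl_EFin//=; last 2 first.
- apply/measurable_EFinP.
  apply: measurableT_comp => //; apply: measurableT_comp => //.
  apply: measurable_funM => //; apply: measurable_funX.
  exact: measurable_funB.
- by rewrite mulr_ge0// powR_ge0.
rewrite integral_gauss// -EFinM -mulrA -powRD; last first.
  by apply/implyP => _; rewrite gt_eqF// divr_gt0// pi_gt0.
by congr (_ * _ `^ _)%:E; rewrite -natr1; field.
Qed.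

End IntegralOverRk.

(** * The Gamma function and the inverse Gamma kernel *)

Section PowerIntegrals.
Variable R : realType.
Implicit Types (a p q x B : R).
Local Notation mu := (@lebesgue_measure R).
Local Notation pos := (`]0%R, +oo[%classic : set R).

Lemma derivable1_continuous (f : R -> R) x : derivable f x 1 -> {for x, continuous f}.
Proof. by move=> /derivable1_diffP; exact: differentiable_continuous. Qed.

Lemma is_derive_continuous (f : R -> R) x (l : R) :
  is_derive x 1 f l -> {for x, continuous f}.
Proof. by move=> [fx _]; exact: derivable1_continuous. Qed.

Lemma integral_pos_le_of_itvcc (f : R -> R) (M : \bar R) :
  measurable_fun pos f -> (forall x, 0 < x -> 0 <= f x) ->
  (forall x y, 0 < x -> x < y -> (\int[mu]_(t in `[x, y]) (f t)%:E <= M)%E) ->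
  (\int[mu]_(t in `]0%R, +oo[) (f t)%:E <= M)%E.
Proof.
move=> mf f0 hM.
pose F (i : nat) : set R := `[i.+2%:R^-1, i.+2%:R]%classic.
have Fpos i : F i `<=` pos.
  move=> x; rewrite /F /= !in_itv /= andbT => /andP[+ _].
  by apply: lt_le_trans; rewrite invr_gt0.
have -> : `]0%R, +oo[%classic = \bigcup_i F i.
  apply/seteqP; split=> [x|x [i _ /Fpos]//].
  rewrite /= in_itv /= andbT => x0.
  pose N := (Num.truncn x + Num.truncn x^-1)%N.
  exists N => //; rewrite /F /= in_itv /=.
  have xN : x < (Num.truncn x).+1%:R by rewrite truncnS_gt.
  have xVN : x^-1 < (Num.truncn x^-1).+1%:R by rewrite truncnS_gt.
  apply/andP; split.
    rewrite invf_ple ?posrE//; apply: (le_trans (ltW xVN)).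
    by rewrite ler_nat ltnS leqW// leq_addl.
  by apply: (le_trans (ltW xN)); rewrite ler_nat ltnS leqW// leq_addr.
apply: integral_le_of_exhaustion => //.
- move=> i j ij; apply/subsetPset => x; rewrite /F /= !in_itv /= => /andP[h1 h2].
  have ijR : i.+2%:R <= j.+2%:R :> R by rewrite ler_nat !ltnS.
  apply/andP; split; last exact: le_trans ijR.
  by apply: le_trans h1; rewrite lef_pV2 ?posrE.
- by move=> i; exact: measurable_itv.
- move=> i; apply/measurable_EFinP; apply: measurable_funS mf => //; exact: Fpos.
- by move=> i x /Fpos; rewrite /= in_itv /= andbT lee_fin => /f0.
- move=> i; apply: hM; first by rewrite invr_gt0.
  by apply: (@lt_trans _ _ 1); rewrite ?invf_lt1 ?ltr1n.
Qed.

Lemma integral_pos_le_of_itvoc (f : R -> R) (M : \bar R) :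
  measurable_fun pos f -> (forall x, 0 < x -> 0 <= f x) ->
  (forall G, 0 < G -> (\int[mu]_(t in `]0%R, G]) (f t)%:E <= M)%E) ->
  (\int[mu]_(t in `]0%R, +oo[) (f t)%:E <= M)%E.
Proof.
move=> mf f0 hM; apply: integral_pos_le_of_itvcc => // x y x0 xy.
apply: le_trans (hM y (lt_trans x0 xy)).
apply: ge0_subset_integral => //.
- apply/measurable_EFinP; apply: measurable_funS mf => // t.
  by rewrite /= !in_itv /= andbT => /andP[].
- by move=> t; rewrite /= in_itv /= => /andP[/f0 + _]; rewrite lee_fin.
- move=> t; rewrite /= !in_itv /= => /andP[xt ->]; rewrite andbT.
  exact: lt_le_trans xt.
Qed.

(** A bound on the increments of the primitive replaces its limits at [0] and at
    infinity, where the integrand may be singular. *)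
Lemma integral_derivative_le (F f : R -> R) (M : R) :
  (forall x, 0 < x -> is_derive x 1 F (f x)) ->
  (forall x, 0 < x -> {for x, continuous f}) ->
  (forall x, 0 < x -> 0 <= f x) ->
  (forall x y, 0 < x -> 0 < y -> F y - F x <= M) ->
  (\int[mu]_(t in `]0%R, +oo[) (f t)%:E <= M%:E)%E.
Proof.
move=> dF cf f0 FM; apply: integral_pos_le_of_itvcc => //.
  apply: open_continuous_measurable_fun => //.
  by move=> x; rewrite inE /= in_itv /= andbT => /cf.
move=> x y x0 xy; have y0 := lt_trans x0 xy.
rewrite (@continuous_FTC2 _ f F)//.
- by rewrite -EFinB lee_fin FM.
- apply: continuous_in_subspaceT => t; rewrite inE /= in_itv /= => /andP[xt _].
  by apply: cf; apply: lt_le_trans xt.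
- split.
  + move=> t; rewrite in_itv /= => /andP[xt _].
    by have [] := dF t (lt_trans x0 xt).
  + by apply: cvg_at_right_filter; exact: is_derive_continuous (dF x x0).
  + by apply: cvg_at_left_filter; exact: is_derive_continuous (dF y y0).
- move=> t; rewrite in_itv /= => /andP[xt _].
  by rewrite derive1E; have [_ ->] := dF t (lt_trans x0 xt).
Qed.

Lemma integral_ge_box (f : R -> R) (a b m : R) : 0 < a -> a <= b -> 0 <= m ->
  (forall x, 0 < x -> 0 <= f x) -> (forall x, a <= x <= b -> m <= f x) ->
  ((m * (b - a))%:E <= \int[mu]_(t in `]0%R, +oo[) (f t)%:E)%E.
Proof.
move=> a0 ab m0 f0 hm.
have abpos : `[a, b]%classic `<=` pos.
  move=> x; rewrite /= !in_itv /= andbT => /andP[+ _]; exact: lt_le_trans.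
have <- : (\int[mu]_(t in pos `&` `[a, b]) (cst m%:E) t = (m * (b - a))%:E)%E.
  rewrite (setIidr abpos) integral_cst//= lebesgue_measure_itv /= lte_fin EFinM.
  have [_|ba] := ltP a b; first by rewrite EFinB.
  by rewrite (@le_anti _ _ a b) ?ab// subrr.
rewrite integral_mkcondr; apply: le_ge0_integral => x /=; rewrite in_itv /= andbT => x0.
  by apply: erestrict_ge0 => y _; rewrite lee_fin.
rewrite patchE; case: ifPn => [|_]; last by rewrite lee_fin f0.
by rewrite inE /= in_itv /= => /hm; rewrite lee_fin.
Qed.

(** With [K = Num.max 1 q], [1 + x <= K * (1 + x / q) <= K * expR (x / q)]. *)
Lemma powR_le_expR q : 0 < q ->
  exists2 C : R, 0 < C & forall x, 0 <= x -> (1 + x) `^ q <= C * expR x.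
Proof.
move=> q0; pose K := Num.max 1 q.
have K1 : 1 <= K by rewrite le_max lexx.
have Kq : q <= K by rewrite le_max lexx orbT.
have K0 : 0 < K by exact: lt_le_trans K1.
exists (K `^ q); first exact: powR_gt0.
move=> x x0; have -> : expR x = expR (x / q) `^ q.
  by rewrite -expRM divfK// gt_eqF.
rewrite -powRM ?expR_ge0 ?(ltW K0)//.
apply: ge0_ler_powR; rewrite ?nnegrE ?(ltW q0) ?addr_ge0 ?mulr_ge0 ?expR_ge0 ?(ltW K0)//.
apply: (@le_trans _ _ (K * (1 + x / q))); last first.
  by rewrite ler_wpM2l ?(ltW K0)// expR_ge1Dx.
rewrite mulrDr mulr1 lerD// mulrCA ler_peMr// ler_pdivlMr// mul1r.
exact: Kq.
Qed.

Lemma is_derive_powR_addl B a x : 0 < B + x ->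
  is_derive x 1 (fun v => (B + v) `^ a) (a * (B + x) `^ (a - 1)).
Proof.
move=> Bx; rewrite -[X in is_derive _ _ _ X]mulr1.
apply: (@is_derive1_comp _ (@powR R ^~ a) (fun v => B + v)).
  exact: is_derive1_powR.
by rewrite -[X in is_derive _ _ _ X]add0r; apply: is_deriveD.
Qed.

Lemma ler_powRN p x y : 0 <= p -> 0 < x -> x <= y -> y `^ (- p) <= x `^ (- p).
Proof.
move=> p0 x0 xy; have y0 := lt_le_trans x0 xy.
rewrite !powRN lef_pV2 ?posrE ?powR_gt0//.
by apply: ge0_ler_powR; rewrite ?nnegrE ?(ltW x0) ?(ltW y0).
Qed.

(** Upper bound: for [x = B / (2 * v)], [(1 + x) `^ (p + 1)] is at most a multiple of
    [expR x], so the integrand is at most a multiple of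
    [(B / 2 + v) `^ (- p - 1)], which has an explicit primitive.
    Lower bound: for [v] between [B] and [2 * B] the integrand is at least
    [(2 * B) `^ (- p - 1) * expR (- 2^-1)]. *)
Lemma integral_inv_gamma_kernel p : 0 < p ->
  exists c C : R, [/\ 0 < c, 0 < C & forall B, 0 < B ->
   ((c * B `^ (- p))%:E <=
     \int[mu]_(v in `]0%R, +oo[) (v `^ (- p - 1) * expR (- (B / (2 * v))))%:E
     <= (C * B `^ (- p))%:E)%E].
Proof.
move=> p0; have p10 : 0 < p + 1 by rewrite addr_gt0.
have NpE : - p - 1 = - (p + 1) by rewrite opprD.
have [C C0 hC] := powR_le_expR p10.
exists (2 `^ (- p - 1) * expR (- 2^-1)), (C / p * 2^-1 `^ (- p)).
split; rewrite ?mulr_gt0 ?powR_gt0 ?expR_gt0 ?invr_gt0// => B B0; apply/andP; split.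
  have -> : 2 `^ (- p - 1) * expR (- 2^-1) * B `^ (- p) =
      (2 * B) `^ (- p - 1) * expR (- 2^-1) * (2 * B - B).
    have -> : 2 * B - B = B by ring.
    rewrite powRM ?ltW// [B `^ (- p - 1)]powRB; last by rewrite (gt_eqF B0) implybT.
    by rewrite powRr1 ?ltW//; field; rewrite gt_eqF.
  apply: integral_ge_box => //.
  - by rewrite ler_peMl ?ltW// ltr1n.
  - by rewrite mulr_ge0 ?powR_ge0 ?expR_ge0.
  - by move=> v _; rewrite mulr_ge0 ?powR_ge0 ?expR_ge0.
  - move=> v /andP[Bv vB]; have v0 := lt_le_trans B0 Bv.
    apply: ler_pM; rewrite ?powR_ge0 ?expR_ge0//.
      by rewrite NpE ler_powRN// ltW.
    by rewrite ler_expR lerN2 ler_pdivrMr ?mulr_gt0// mulKf// gt_eqF.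
have B20 : 0 < B / 2 by rewrite divr_gt0.
apply: (@le_trans _ _
    (\int[mu]_(v in `]0%R, +oo[) (C * (B / 2 + v) `^ (- p - 1))%:E)%E).
  apply: le_ge0_integral => v; rewrite /= in_itv /= andbT => v0; rewrite lee_fin.
    by rewrite mulr_ge0 ?powR_ge0 ?expR_ge0.
  have w0 : 0 <= B / (2 * v) by rewrite divr_ge0 ?mulr_ge0 ?ltW.
  have -> : B / 2 + v = v * (1 + B / (2 * v)) by field; rewrite gt_eqF.
  rewrite powRM ?addr_ge0 ?(ltW v0)// mulrCA ler_wpM2l ?powR_ge0//.
  rewrite NpE powRN expRN ler_pdivlMr ?powR_gt0 ?ltr_wpDr//.
  by rewrite ler_pdivrMl ?expR_gt0// [_ * C]mulrC hC.
apply: (@integral_derivative_le (fun v => - (C / p) * (B / 2 + v) `^ (- p))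
  (fun v => C * (B / 2 + v) `^ (- p - 1)) (C / p * 2^-1 `^ (- p) * B `^ (- p))).
- move=> v v0; have Bv : 0 < B / 2 + v by rewrite addr_gt0.
  have -> : C * (B / 2 + v) `^ (- p - 1) =
      - (C / p) *: (- p * (B / 2 + v) `^ (- p - 1)).
    by rewrite /GRing.scale /=; field; rewrite gt_eqF.
  by apply: is_deriveZ; exact: is_derive_powR_addl.
- move=> v v0; apply: continuousM; first exact: cst_continuous.
  by apply: is_derive_continuous; apply: is_derive_powR_addl; rewrite addr_gt0.
- by move=> v v0; rewrite mulr_ge0 ?powR_ge0 ?ltW.
- move=> x y x0 y0; rewrite !mulNr opprK addrC -[leRHS]subr0 lerB//; last first.
    by rewrite mulr_ge0 ?powR_ge0// ltW// divr_gt0.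
  rewrite -[leRHS]mulrA ler_wpM2l//; first by rewrite ltW// divr_gt0.
  rewrite -powRM ?(ltW B0) ?invr_ge0// [_^-1 * B]mulrC.
  by rewrite ler_powRN ?(ltW p0)// lerDl ltW.
Qed.

Lemma measurable_inv_gamma_kernel p B :
  measurable_fun pos (fun v : R => v `^ (- p - 1) * expR (- (B / (2 * v)))).
Proof.
apply: open_continuous_measurable_fun => //.
move=> v; rewrite inE /= in_itv /= andbT => v0.
apply: (@continuousM R R (fun v => v `^ (- p - 1))).
  by apply: is_derive_continuous; exact: is_derive1_powR.
apply: (@continuous_comp R R R (fun v => - (B / (2 * v))) expR v); last first.
  exact: continuous_expR.
apply: cvgN; apply: cvgM; first exact: cvg_cst.
apply: cvgV; first by rewrite gt_eqF// mulr_gt0.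
by apply: cvgM; [exact: cvg_cst|exact: cvg_id].
Qed.

Lemma integral_inv_gamma_kernelZ p : 0 < p ->
  exists c C : R, [/\ 0 < c, 0 < C & forall A B, 0 <= A -> 0 < B ->
   ((A * (c * B `^ (- p)))%:E <=
     \int[mu]_(v in `]0%R, +oo[) (A * (v `^ (- p - 1) * expR (- (B / (2 * v)))))%:E
     <= (A * (C * B `^ (- p)))%:E)%E].
Proof.
move=> /integral_inv_gamma_kernel[c [C [c0 C0 H]]]; exists c, C; split=> // A B A0 B0.
under eq_integral do rewrite EFinM.
rewrite ge0_integralZl_EFin//; last 2 first.
- by move=> v _; rewrite lee_fin mulr_ge0 ?powR_ge0 ?expR_ge0.
- apply/measurable_EFinP; exact: measurable_inv_gamma_kernel.
have /andP[H1 H2] := H B B0.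
by rewrite EFinM (EFinM A) !lee_wpmul2l ?lee_fin.
Qed.

(** [gamma_fun a] is by convention [0] when its integral diverges, so convergence
    has to be shown. As [(1 + x) `^ (a + 1)] is at most a multiple of [expR x], the
    integrand is at most a multiple of [x `^ (a - 1) * (1 + x) `^ (- a - 1)], the
    derivative of [(x / (1 + x)) `^ a / a]; the latter is written with
    [1 + x^-1] below. *)
Lemma gamma_fun_gt0 a : 0 < a -> 0 < gamma_fun a.
Proof.
move=> a0; have a10 : 0 < a + 1 by rewrite addr_gt0.
have [C C0 hC] := powR_le_expR a10.
have k0 x : 0 <= x `^ (a - 1) * expR (- x) by rewrite mulr_ge0 ?powR_ge0 ?expR_ge0.
rewrite /gamma_fun /Rintegral; apply: fine_gt0; apply/andP; split.
  have m0 : 0 < Num.min 1 (2 `^ (a - 1)) * expR (- 2).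
    by rewrite mulr_gt0 ?expR_gt0// lt_min ltr01 powR_gt0.
  apply: (@lt_le_trans _ _ (Num.min 1 (2 `^ (a - 1)) * expR (- 2) * (2 - 1))%:E).
    by rewrite lte_fin mulr_gt0// subr_gt0 ltr1n.
  apply: integral_ge_box => //; rewrite ?ler1n ?(ltW m0)//.
  move=> x /andP[x1 x2]; apply: ler_pM; rewrite ?le_min ?ler01 ?powR_ge0 ?expR_ge0 ?ler_expR ?lerN2//.
  rewrite ge_min; have [a1|/ltW a1] := leP 1 a.
    by rewrite -[X in X <= _](powRr0 x) ler_powR ?subr_ge0.
  apply/orP; right; rewrite -[a - 1]opprB; apply: ler_powRN => //.
    by rewrite subr_ge0.
  exact: lt_le_trans x1.
apply: (@le_lt_trans _ _ (C / a)%:E); last exact: ltry.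
apply: (@le_trans _ _
    (\int[mu]_(x in `]0%R, +oo[) (C * ((1 + x^-1) `^ (- a - 1) * x ^- 2))%:E)%E).
  apply: le_ge0_integral => x; rewrite /= in_itv /= andbT => x0; rewrite lee_fin//.
  have -> : (1 + x^-1) `^ (- a - 1) * x ^- 2 = x `^ (a - 1) * (1 + x) `^ (- (a + 1)).
    have -> : 1 + x^-1 = (1 + x) * x^-1 by field; rewrite gt_eqF.
    rewrite -opprD powRM ?addr_ge0 ?invr_ge0 ?(ltW x0)// -mulrA mulrC; congr (_ * _).
    rewrite -(powR_inv1 (ltW x0)) -powRrM mulN1r opprK -(powR_invn 2 (ltW x0)).
    by rewrite -powRD ?(gt_eqF x0) ?implybT//; congr (_ `^ _); ring.
  rewrite mulrCA ler_wpM2l ?powR_ge0// powRN expRN.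
  rewrite ler_pdivlMr ?powR_gt0 ?addr_gt0// ler_pdivrMl ?expR_gt0// [_ * C]mulrC.
  by rewrite hC// ltW.
have dV x : 0 < x -> is_derive x 1 (fun x : R => 1 + x^-1) (- x ^- 2).
  move=> x0; rewrite -[X in is_derive _ _ _ X]add0r; apply: is_deriveD.
  rewrite -[X in is_derive _ _ _ X]mulr1.
  by apply: (@is_deriveV _ id); rewrite ?gt_eqF//; exact: is_derive_id.
have V0 x : 0 < x -> 0 < 1 + x^-1 by move=> x0; rewrite addr_gt0 ?invr_gt0.
apply: (@integral_derivative_le (fun x => C / a * (1 + x^-1) `^ (- a))
  (fun x => C * ((1 + x^-1) `^ (- a - 1) * x ^- 2)) (C / a)).
- move=> x x0.
  have -> : C * ((1 + x^-1) `^ (- a - 1) * x ^- 2) =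
      (C / a) *: ((- a * (1 + x^-1) `^ (- a - 1)) * - x ^- 2).
    by rewrite /GRing.scale /=; field; rewrite !gt_eqF.
  apply: is_deriveZ.
  apply: (@is_derive1_comp _ (@powR R ^~ (- a)) (fun x => 1 + x^-1)).
    exact/is_derive1_powR/V0.
  exact: dV.
- move=> x x0; apply: continuousM; first exact: cst_continuous.
  apply: continuousM.
    apply: is_derive_continuous.
    apply: (@is_derive1_comp _ (@powR R ^~ (- a - 1)) (fun x => 1 + x^-1)).
      exact/is_derive1_powR/V0.
    exact: dV.
  apply: continuousV; first by rewrite sqrf_eq0 gt_eqF.
  exact: exprn_continuous.
- by move=> x x0; rewrite !mulr_ge0 ?powR_ge0 ?invr_ge0 ?sqr_ge0 ?(ltW C0).
- move=> x y x0 y0; rewrite -[leRHS]subr0 lerB//; last first.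
    by rewrite mulr_ge0 ?powR_ge0// ltW// divr_gt0.
  rewrite -[leRHS]mulr1 ler_wpM2l//; first by rewrite ltW// divr_gt0.
  rewrite -[leRHS](powRr0 (1 + y^-1)) ler_powR ?oppr_le0 ?(ltW a0)//.
  by rewrite lerDl invr_ge0 ltW.
Qed.

End PowerIntegrals.

(** * Scaled Gaussian and inverse chi-square densities *)

Section GaussianDensities.
Variable R : realType.
Local Notation mu := (@lebesgue_measure R).

Lemma mvnormal_pdf_scale k (m x : 'cV[R]_k) (V : 'M[R]_k) (v : R) :
  posdefmx V -> 0 < v ->
  mvnormal_pdf m (v *: V) x =
  (Num.sqrt ((2 * pi) ^+ k * \det V))^-1 * v `^ (- (k%:R / 2))
  * expR (- (qform (invmx V) (x - m) / (2 * v))).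
Proof.
move=> Vp v0; have d0 := posdef_det_gt0 Vp.
rewrite /mvnormal_pdf invmxZ; last exact/posdef_unitmx/posdef_scale.
rewrite qform_scale detZ mulrCA sqrtrM ?exprn_ge0 ?ltW//.
have -> : Num.sqrt (v ^+ k) = v `^ (k%:R / 2).
  by rewrite -powR12_sqrt ?exprn_ge0 ?ltW// -powR_mulrn ?ltW// -powRrM.
rewrite invfM -powRN; congr (_ * expR (- _)); first by rewrite mulrC.
by field; rewrite gt_eqF.
Qed.

Lemma mvnormal_cst_gt0 k (V : 'M[R]_k) : posdefmx V ->
  0 < (Num.sqrt ((2 * pi) ^+ k * \det V))^-1.
Proof.
move=> Vp; rewrite invr_gt0 sqrtr_gt0 mulr_gt0 ?posdef_det_gt0//.
by rewrite exprn_gt0// mulr_gt0// pi_gt0.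
Qed.

Lemma inv_chi2_cst_gt0 (s nu : R) : 0 < s -> 0 <= nu -> 0 < inv_chi2_cst s nu.
Proof.
move=> s0 nu0; rewrite /inv_chi2_cst; case: ifPn => // nu_neq0.
have nu_gt0 : 0 < nu / 2 by rewrite divr_gt0// lt_neqAle eq_sym nu_neq0.
by rewrite divr_gt0 ?gamma_fun_gt0// mulr_gt0 ?powR_gt0.
Qed.

Lemma integral_cV_gauss_scaled k (A c v : R) (m : 'cV[R]_k) :
  0 <= A -> 0 < c -> 0 < v ->
  integral_cV (fun x => (A * expR (- (c * sqn (x - m) / (2 * v))))%:E) =
  (A * ((2 * pi / c) `^ (k%:R / 2) * v `^ (k%:R / 2)))%:E.
Proof.
move=> A0 c0 v0; have a0 : 0 < c / (2 * v) by rewrite divr_gt0// mulr_gt0.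
transitivity (integral_cV
    (fun x : 'cV_k => (A * expR (- (c / (2 * v) * sqn (x - m))))%:E)).
  by apply: eq_integral_cV => x; rewrite mulrAC.
rewrite integral_cV_gauss// -powRM; last 2 first.
- by rewrite divr_ge0 ?mulr_ge0 ?pi_ge0 ?ltW.
- exact: ltW.
by congr (_ * _ `^ _)%:E; field; rewrite !gt_eqF.
Qed.

Lemma sqn_complete_square k (a b : R) (x m : 'cV[R]_k) : 0 < a -> 0 < b ->
  a * sqn (x - m) + b * sqn x =
  (a + b) * sqn (x - (a / (a + b)) *: m) + a * b / (a + b) * sqn m.
Proof.
move=> a0 b0; have ab : a + b != 0 by rewrite gt_eqF// addr_gt0.
rewrite !sqnE !mulr_sumr -!big_split /=; apply: eq_bigr => i _.
by rewrite !mxE; field.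
Qed.

(** The first factor is a likelihood of precision [c1 / v] centred at [m], the
    second a prior of precision [c2 / (g * v)] centred at [0]. Completing the square
    leaves [m] weighted by [c1 * c2 / (c1 * g + c2)], which decays like [g^-1]: a
    diffuse prior hardly penalizes a remote estimate. *)
Lemma integral_cV_two_gauss k (A c1 c2 g v : R) (m : 'cV[R]_k) :
  0 <= A -> 0 < c1 -> 0 < c2 -> 0 < g -> 0 < v ->
  integral_cV (fun x => (A * expR (- (c1 * sqn (x - m) / (2 * v)))
                         * expR (- (c2 * sqn x / (2 * (g * v)))))%:E) =
  (A * expR (- (c1 * c2 / (c1 * g + c2) * sqn m / (2 * v)))
   * ((2 * pi / (c1 * g + c2)) `^ (k%:R / 2) * (g * v) `^ (k%:R / 2)))%:E.
Proof.
move=> A0 c10 c20 g0 v0; have gv0 : 0 < g * v by rewrite mulr_gt0.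
have d0 : 0 < c1 * g + c2 by rewrite addr_gt0// mulr_gt0.
rewrite -(integral_cV_gauss_scaled ((c1 * g / (c1 * g + c2)) *: m)) ?mulr_ge0 ?expR_ge0//.
apply: eq_integral_cV => x; congr (_%:E).
rewrite -[LHS]mulrA -[RHS]mulrA -!expRD; congr (_ * expR _).
have c1g0 : 0 < c1 * g by rewrite mulr_gt0.
have := sqn_complete_square x m c1g0 c20.
set m' := _ *: m.
move: (sqn (x - m)) (sqn x) (sqn m) (sqn (x - m')) => q1 q2 q3 q4 E.
have -> : q4 = (c1 * g * q1 + c2 * q2 - c1 * g * c2 / (c1 * g + c2) * q3) / (c1 * g + c2).
  by rewrite E; field; rewrite gt_eqF.
by field; rewrite !gt_eqF.
Qed.

End GaussianDensities.

(** * Comparison of power functions *)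

Section PowerComparison.
Variable R : realType.

(** Up to constants, the marginal likelihood of the alternative given [g], with
    [h = r1 / 2] and [t] the squared norm of the estimate: the scale of the
    inverse Gamma integral is a fixed [D] plus the penalized squared norm. *)
Definition precision_kernel (D d1 d2 h p g t : R) : R :=
  (d1 * g + d2) `^ (- h) * (D + d1 * d2 / (d1 * g + d2) * t) `^ (- p).

Lemma powRN_sandwich (p l u X Y : R) : 0 <= p -> 0 < l -> 0 < X -> 0 < u ->
  (l * X <= Y -> Y `^ (- p) <= l `^ (- p) * X `^ (- p)) /\
  (0 < Y -> Y <= u * X -> u `^ (- p) * X `^ (- p) <= Y `^ (- p)).
Proof.
move=> p0 l0 X0 u0; split=> [lY|Y0 Yu].
  by rewrite -powRM ?(ltW l0) ?(ltW X0)// ler_powRN// mulr_gt0.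
by rewrite -powRM ?(ltW u0) ?(ltW X0)// ler_powRN.
Qed.

Lemma affine_sandwich (a b t : R) : 0 <= t ->
  Num.min a b * (1 + t) <= a + b * t <= Num.max a b * (1 + t).
Proof.
move=> t0; rewrite !mulrDr !mulr1; apply/andP; split; apply: lerD.
- by rewrite ge_min lexx.
- by rewrite ler_wpM2r// ge_min lexx orbT.
- by rewrite le_max lexx.
- by rewrite ler_wpM2r// le_max lexx orbT.
Qed.

(** The second factor is of order [((1 + g + t) / (1 + g)) `^ (- p)], and
    [1 + g + t] lies between [1 + t] and, as long as [g <= t], twice that. *)
Lemma precision_kernel_sandwich (D d1 d2 h p : R) :
  0 < D -> 0 < d1 -> 0 < d2 -> 0 <= h -> 0 <= p ->
  exists l u : R, [/\ 0 < l, 0 < u & forall g t, 0 < g -> 0 <= t ->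
    let Q := precision_kernel D d1 d2 h p g t in
    let E := (g + 1) `^ (p - h) * (1 + t) `^ (- p) in
    Q <= u * E /\ (g <= t -> l * E <= Q)].
Proof.
move=> D0 d10 d20 h0 p0; set m := Num.min d1 d2; set M := Num.max d1 d2.
have m0 : 0 < m by rewrite lt_min d10.
have M0 : 0 < M by rewrite lt_max d10.
set a := Num.min D (d1 * d2 / M); set b := 2 * Num.max D (d1 * d2 / m).
have d12 : 0 < d1 * d2 by rewrite mulr_gt0.
have a0 : 0 < a by rewrite lt_min D0 divr_gt0.
have b0 : 0 < b by rewrite mulr_gt0// lt_max D0.
exists (M `^ (- h) * b `^ (- p)), (m `^ (- h) * a `^ (- p)).
split; rewrite ?mulr_gt0 ?powR_gt0// => g t g0 t0 Q E.
have G0 : 0 < g + 1 by rewrite addr_gt0.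
have T0 : 0 < 1 + t by rewrite ltr_pwDl.
have X0 : 0 < (1 + t) / (g + 1) by rewrite divr_gt0.
have dg0 : 0 < d1 * g + d2 by rewrite addr_gt0// mulr_gt0.
have /andP[dl du] : m * (g + 1) <= d1 * g + d2 <= M * (g + 1).
  by rewrite /m /M minC maxC addrC [d1 * g + _]addrC affine_sandwich// ltW.
have Y0 : 0 < D + d1 * d2 / (d1 * g + d2) * t.
  by rewrite ltr_pwDl// mulr_ge0// ltW// divr_gt0.
have EE : E = (g + 1) `^ (- h) * ((1 + t) / (g + 1)) `^ (- p).
  rewrite powRM ?invr_ge0 ?(ltW T0) ?(ltW G0)// -(powR_inv1 (ltW G0)) -powRrM mulN1r opprK.
  by rewrite /E [p - h]addrC powRD ?(gt_eqF G0) ?implybT// mulrAC mulrA.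
have tg0 : 0 <= t / (g + 1) by rewrite divr_ge0 ?(ltW G0).
have [dh1 dh2] := @powRN_sandwich h m M (g + 1) (d1 * g + d2) h0 m0 G0 M0.
have [yp1 yp2] := @powRN_sandwich p a b _ (D + d1 * d2 / (d1 * g + d2) * t) p0 a0 X0 b0.
have compare (x y : R) : 0 < x -> x <= y -> d1 * d2 / y * t <= d1 * d2 / x * t.
  move=> x0 xy; rewrite ler_wpM2r// ler_wpM2l ?(ltW d12)//.
  by rewrite lef_pV2 ?posrE// (lt_le_trans x0).
have regroup (x : R) : 0 < x -> d1 * d2 / x * (t / (g + 1)) = d1 * d2 / (x * (g + 1)) * t.
  by move=> x0; field; rewrite !gt_eqF.
split.
- rewrite EE mulrACA ler_pM ?powR_ge0 ?dh1 ?yp1//.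
  apply: (@le_trans _ _ (a * (1 + t / (g + 1)))).
    rewrite ler_wpM2l ?(ltW a0)// ler_pdivrMr// mulrDl mul1r divfK ?gt_eqF//.
    by rewrite lerD2r lerDr ltW.
  have /andP[+ _] := affine_sandwich D (d1 * d2 / M) tg0.
  by move=> /le_trans; apply; rewrite lerD2l regroup// compare.
- move=> gt; rewrite EE mulrACA ler_pM ?mulr_ge0 ?powR_ge0 ?dh2 ?yp2//.
  apply: (@le_trans _ _ (Num.max D (d1 * d2 / m) * (1 + t / (g + 1)))).
    have /andP[_] := affine_sandwich D (d1 * d2 / m) tg0.
    apply: le_trans; rewrite lerD2l regroup// compare// mulr_gt0//.
  rewrite /b [2 * _]mulrC -[leRHS]mulrA ler_wpM2l ?le_max ?(ltW D0)//.
  rewrite mulrA ler_pdivlMr// mulrDl mul1r divfK ?gt_eqF//.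
  by lra.
Qed.

End PowerComparison.

(** * The marginal likelihoods up to constants *)

Section Marginals.
Variables (R : realType) (n r1 r2 : nat).
Variables (Xt : 'M[R]_(n, r1)) (Xg : 'M[R]_(n, r2)) (Sigma : 'M[R]_n).
Hypotheses (hSigma : posdefmx Sigma)
  (hrank : \rank (row_mx Xt Xg) = (r1 + r2)%N)
  (horth : Xt^T *m invmx Sigma *m Xg = 0).

Local Notation I := (Xt^T *m invmx Sigma *m Xt).
Local Notation J := (Xg^T *m invmx Sigma *m Xg).
Local Notation th_hat := (theta_hat Xt Sigma).
Local Notation ga_hat := (gamma_hat Xg Sigma).
Local Notation rss := (s2_resid Xt Xg Sigma).
Local Notation mu := (@lebesgue_measure R).

Lemma likelihoodE y th ga v : 0 < v ->
  likelihood Xt Xg Sigma y th ga v =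
  (Num.sqrt ((2 * pi) ^+ n * \det Sigma))^-1 * v `^ (- (n%:R / 2))
  * expR (- ((rss y + qform I (th - th_hat y)) / (2 * v)))
  * expR (- (qform J (ga - ga_hat y) / (2 * v))).
Proof.
move=> v0; rewrite /likelihood mvnormal_pdf_scale// rss_decomposition//.
rewrite -[RHS]mulrA -expRD; congr (_ * expR _).
by rewrite -opprD -mulrDl.
Qed.

(** In gamma the likelihood is a Gaussian kernel of precision [J / v], whose mass is a
    constant times [v `^ (r2 / 2)]: it only turns [n] into [n - r2]. *)
Lemma nuisance_integral_bounds :
  exists k K : R, [/\ 0 < k, 0 < K & forall y th v w, 0 < v -> 0 <= w ->
    let E := v `^ (- ((n%:R - r2%:R) / 2))
             * expR (- ((rss y + qform I (th - th_hat y)) / (2 * v))) * w in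
    let L := integral_cV (fun ga : 'cV[R]_r2 =>
        (likelihood Xt Xg Sigma y th ga v * w)%:E) in
    ((k * E)%:E <= L)%E /\ (L <= (K * E)%:E)%E].
Proof.
have [c [C [c0 C0 hJ]]] := posdef_equiv_sqn (posdef_J hSigma hrank).
set N := (Num.sqrt ((2 * pi) ^+ n * \det Sigma))^-1.
have N0 : 0 < N by exact: mvnormal_cst_gt0.
have pc (d : R) : 0 < d -> 0 < N * (2 * pi / d) `^ (r2%:R / 2).
  by move=> d0; rewrite mulr_gt0// powR_gt0// divr_gt0// mulr_gt0// pi_gt0.
exists (N * (2 * pi / C) `^ (r2%:R / 2)), (N * (2 * pi / c) `^ (r2%:R / 2)).
split; [exact: pc|exact: pc|] => y th v w v0 w0 E L.
pose A := N * v `^ (- (n%:R / 2))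
  * expR (- ((rss y + qform I (th - th_hat y)) / (2 * v))) * w.
have A0 : 0 <= A by rewrite !mulr_ge0 ?powR_ge0 ?expR_ge0 ?(ltW N0).
have valE (d : R) : 0 < d ->
    (N * (2 * pi / d) `^ (r2%:R / 2) * E)%:E =
    integral_cV (fun ga => (A * expR (- (d * sqn (ga - ga_hat y) / (2 * v))))%:E).
  move=> d0; rewrite integral_cV_gauss_scaled//; congr (_%:E); rewrite /A /E.
  have -> : - ((n%:R - r2%:R) / 2) = - (n%:R / 2) + r2%:R / 2 :> R by field.
  by rewrite powRD ?(gt_eqF v0) ?implybT//; ring.
have lE ga : likelihood Xt Xg Sigma y th ga v * w =
    A * expR (- (qform J (ga - ga_hat y) / (2 * v))).
  by rewrite likelihoodE// /A -/N mulrAC.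
have v20 : 0 < (2 * v)^-1 by rewrite invr_gt0 mulr_gt0.
split; rewrite valE//; apply: le_integral_cV => ga; rewrite lee_fin ?lE.
- by rewrite mulr_ge0 ?expR_ge0.
- rewrite ler_wpM2l// ler_expR lerN2 ler_pM2r//.
  by have /andP[] := hJ (ga - ga_hat y).
- by rewrite mulr_ge0 ?expR_ge0.
- rewrite ler_wpM2l// ler_expR lerN2 ler_pM2r//.
  by have /andP[] := hJ (ga - ga_hat y).
Qed.

Section NullHypothesis.
Variables (s nu : R).
Hypotheses (hs : 0 < s) (hnu : 0 <= nu) (hn : (r2 < n)%N).

Lemma df_gt0 : 0 < (n%:R - r2%:R + nu) / 2.
Proof. by rewrite divr_gt0// ltr_wpDr// subr_gt0 ltr_nat. Qed.

(** Conjugacy: the prior adds [nu] to the degrees of freedom and [nu * s ^+ 2] to the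
    scale. *)
Lemma inv_chi2_pdfM (v T : R) : 0 < v ->
  v `^ (- ((n%:R - r2%:R) / 2)) * expR (- (T / (2 * v))) * inv_chi2_pdf s nu v
  = inv_chi2_cst s nu * (v `^ (- ((n%:R - r2%:R + nu) / 2) - 1)
      * expR (- ((T + nu * s ^+ 2) / (2 * v)))).
Proof.
move=> v0; rewrite /inv_chi2_pdf.
have -> : - ((n%:R - r2%:R + nu) / 2) - 1 =
    - ((n%:R - r2%:R) / 2) + (- (nu / 2) - 1) :> R by field.
have -> : expR (- ((T + nu * s ^+ 2) / (2 * v))) =
    expR (- (T / (2 * v))) * expR (- (nu * s ^+ 2 / (2 * v))).
  by rewrite -expRD -opprD -mulrDl.
by rewrite [in RHS]powRD ?(gt_eqF v0) ?implybT//; ring.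
Qed.

Lemma inv_chi2_pdf_ge0 v : 0 <= inv_chi2_pdf s nu v.
Proof.
by rewrite !mulr_ge0 ?powR_ge0 ?expR_ge0// ltW// inv_chi2_cst_gt0.
Qed.

Lemma marginal0_kernel_bounds :
  exists k K : R, [/\ 0 < k, 0 < K & forall y, 0 < rss y ->
    let E := (rss y + qform I (th_hat y) + nu * s ^+ 2)
             `^ (- ((n%:R - r2%:R + nu) / 2)) in
    ((k * E)%:E <= marginal0 Xt Xg Sigma s nu y)%E /\
    (marginal0 Xt Xg Sigma s nu y <= (K * E)%:E)%E].
Proof.
have [k [K [k0 K0 H]]] := nuisance_integral_bounds.
have [c [C [c0 C0 HI]]] := integral_inv_gamma_kernelZ df_gt0.
have x0 := inv_chi2_cst_gt0 hs hnu; set x := inv_chi2_cst s nu in x0.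
exists (k * x * c), (K * x * C); split; rewrite ?mulr_gt0// => y ry E.
have B0 : 0 < rss y + qform I (th_hat y) + nu * s ^+ 2.
  rewrite -addrA ltr_pwDl// addr_ge0 ?mulr_ge0 ?(ltW hs)//.
  exact/posdef_qform_ge0/(posdef_I hSigma hrank).
have /andP[L _] := HI (k * x) _ (ltW (mulr_gt0 k0 x0)) B0.
have /andP[_ U] := HI (K * x) _ (ltW (mulr_gt0 K0 x0)) B0.
split; rewrite -mulrA.
- apply: (le_trans L); apply: le_ge0_integral => v; rewrite /= in_itv /= andbT => v0.
    by rewrite lee_fin !mulr_ge0 ?powR_ge0 ?expR_ge0 ?(ltW k0) ?(ltW x0).
  have [+ _] := H y 0 v _ v0 (inv_chi2_pdf_ge0 v).
  by rewrite sub0r qformN inv_chi2_pdfM// mulrA.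
- apply: le_trans U; apply: le_ge0_integral => v; rewrite /= in_itv /= andbT => v0.
    apply: integral_cV_ge0 => ga; rewrite lee_fin mulr_ge0 ?inv_chi2_pdf_ge0//.
    by rewrite /likelihood/mvnormal_pdf mulr_ge0 ?expR_ge0// invr_ge0.
  have [_] := H y 0 v _ v0 (inv_chi2_pdf_ge0 v).
  by rewrite sub0r qformN inv_chi2_pdfM// mulrA.
Qed.

End NullHypothesis.

Section AlternativeHypothesis.
Variables (Omega : 'M[R]_r1) (s nu : R).
Hypotheses (hOmega : posdefmx Omega) (hs : 0 < s) (hnu : 0 <= nu) (hn : (r2 < n)%N).

(** In theta, the likelihood and the prior are replaced by isotropic Gaussian
    kernels, with large precisions for the lower bound and small ones for the
    upper bound. *)
Lemma marginal1_kernel_bounds :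
  exists k K c1 c2 C1 C2 : R,
  [/\ [/\ 0 < k, 0 < K, 0 < c1 & 0 < c2], 0 < C1, 0 < C2 &
    forall y g, 0 < rss y -> 0 < g ->
    let Q d1 d2 := precision_kernel (rss y + nu * s ^+ 2) d1 d2 (r1%:R / 2)
                     ((n%:R - r2%:R + nu) / 2) g (sqn (th_hat y)) in
    ((k * Q C1 C2)%:E <= marginal1_given Xt Xg Sigma Omega s nu g y)%E /\
    (marginal1_given Xt Xg Sigma Omega s nu g y <= (K * Q c1 c2)%:E)%E].
Proof.
have [k [K [k0 K0 H]]] := nuisance_integral_bounds.
have [c [C [c0 C0 HG]]] := integral_inv_gamma_kernelZ (df_gt0 hnu hn).
have [c1 [C1 [c10 C10 hI]]] := posdef_equiv_sqn (posdef_I hSigma hrank).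
have [c2 [C2 [c20 C20 hW]]] := posdef_equiv_sqn (posdef_inv hOmega).
have x0 := inv_chi2_cst_gt0 hs hnu; set x := inv_chi2_cst s nu in x0.
set N := (Num.sqrt ((2 * pi) ^+ r1 * \det Omega))^-1.
have N0 : 0 < N by exact: mvnormal_cst_gt0.
have P0 : 0 < (2 * pi) `^ (r1%:R / 2) :> R by rewrite powR_gt0// mulr_gt0// pi_gt0.
pose coef (b : R) := b * N * x * (2 * pi) `^ (r1%:R / 2).
have coef0 b : 0 < b -> 0 < coef b by move=> b0; rewrite !mulr_gt0.
exists (coef k * c), (coef K * C), c1, c2, C1, C2.
split=> //; first by split=> //; rewrite mulr_gt0 ?coef0.
move=> y g ry g0 Q.
pose B (d1 d2 : R) := rss y + d1 * d2 / (d1 * g + d2) * sqn (th_hat y) + nu * s ^+ 2.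
have dg (d1 d2 : R) : 0 < d1 -> 0 < d2 -> 0 < d1 * g + d2.
  by move=> ? ?; rewrite addr_gt0// mulr_gt0.
have B0 d1 d2 : 0 < d1 -> 0 < d2 -> 0 < B d1 d2.
  move=> d10 d20; rewrite /B -addrA ltr_pwDl// addr_ge0 ?mulr_ge0 ?sqn_ge0 ?(ltW hs)//.
  - exact: ltW.
  - exact: ltW.
  - by rewrite invr_ge0 ltW// dg.
pose D (d1 d2 : R) := (d1 * g + d2) `^ (- (r1%:R / 2)).
have coef_ge0 b d1 d2 : 0 < b -> 0 <= coef b * D d1 d2.
  by move=> b0; rewrite mulr_ge0 ?powR_ge0// ltW ?coef0.
pose gaussian b (d1 d2 v : R) (th : 'cV[R]_r1) :=
  b * (v `^ (- ((n%:R - r2%:R) / 2)) * expR (- (rss y / (2 * v)))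
       * (N * (g * v) `^ (- (r1%:R / 2)) * inv_chi2_pdf s nu v))
  * expR (- (d1 * sqn (th - th_hat y) / (2 * v)))
  * expR (- (d2 * sqn th / (2 * (g * v)))).
have pdf0 v : 0 <= inv_chi2_pdf s nu v by exact: inv_chi2_pdf_ge0.
have gaussian_ge0 b d1 d2 v th : 0 < b -> 0 <= gaussian b d1 d2 v th.
  move=> b0; rewrite /gaussian !mulr_ge0 ?powR_ge0 ?expR_ge0 ?(ltW b0) ?(ltW N0)//.
  exact: ltW.
(* The powers of [g * v] from the prior density and from the Gaussian integral
   cancel; the precision [d1 * g + d2] is all that remains of [g] up front. *)
have gaussianE b d1 d2 v : 0 < b -> 0 < d1 -> 0 < d2 -> 0 < v ->
    integral_cV (fun th => (gaussian b d1 d2 v th)%:E) =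
    (coef b * D d1 d2 * (v `^ (- ((n%:R - r2%:R + nu) / 2) - 1)
       * expR (- (B d1 d2 / (2 * v)))))%:E.
  move=> b0 d10 d20 v0; have gv0 : 0 < g * v by rewrite mulr_gt0.
  have A0 : 0 <= b * (v `^ (- ((n%:R - r2%:R) / 2)) * expR (- (rss y / (2 * v)))
       * (N * (g * v) `^ (- (r1%:R / 2)) * inv_chi2_pdf s nu v)).
    rewrite !mulr_ge0 ?powR_ge0 ?expR_ge0 ?(ltW b0) ?(ltW N0)//; exact: ltW.
  rewrite /gaussian integral_cV_two_gauss//.
  have -> : (2 * pi / (d1 * g + d2)) `^ (r1%:R / 2) =
      (2 * pi) `^ (r1%:R / 2) * D d1 d2.
    rewrite powRM ?mulr_ge0 ?pi_ge0 ?invr_ge0 ?(ltW (dg _ _ _ _))//; congr (_ * _).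
    by rewrite -(powR_inv1 (ltW (dg _ _ d10 d20))) -powRrM mulN1r.
  have E : (g * v) `^ (- (r1%:R / 2)) * (g * v) `^ (r1%:R / 2) = 1.
    by rewrite powRN mulVf// gt_eqF// powR_gt0.
  set T := rss y + d1 * d2 / (d1 * g + d2) * sqn (th_hat y).
  have e12 : expR (- (rss y / (2 * v)))
      * expR (- (d1 * d2 / (d1 * g + d2) * sqn (th_hat y) / (2 * v))) =
      expR (- (T / (2 * v))).
    by rewrite -expRD -opprD -mulrDl.
  have pdfE := inv_chi2_pdfM s nu T v0.
  rewrite -/(B d1 d2) -/x in pdfE; congr (_%:E).
  transitivity (b * N * (2 * pi) `^ (r1%:R / 2) * D d1 d2 *
      (v `^ (- ((n%:R - r2%:R) / 2)) * expR (- (T / (2 * v))) * inv_chi2_pdf s nu v)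
      * ((g * v) `^ (- (r1%:R / 2)) * (g * v) `^ (r1%:R / 2))).
    by rewrite -e12; ring.
  by rewrite E mulr1 pdfE /coef; ring.
pose w v (th : 'cV[R]_r1) :=
  mvnormal_pdf 0 ((g * v) *: Omega) th * inv_chi2_pdf s nu v.
have wE v th : 0 < v -> w v th = N * (g * v) `^ (- (r1%:R / 2))
    * inv_chi2_pdf s nu v * expR (- (qform (invmx Omega) th / (2 * (g * v)))).
  move=> v0; rewrite /w mvnormal_pdf_scale ?mulr_gt0// subr0 -/N.
  by rewrite mulrAC.
have w0 v th : 0 < v -> 0 <= w v th.
  move=> v0; rewrite wE// mulr_ge0 ?expR_ge0// mulr_ge0 ?pdf0//.
  by rewrite mulr_ge0 ?powR_ge0// ltW.
pose inner v th := integral_cV (fun ga : 'cV[R]_r2 =>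
  (likelihood Xt Xg Sigma y th ga v * mvnormal_pdf 0 ((g * v) *: Omega) th
   * inv_chi2_pdf s nu v)%:E).
have innerE v th : inner v th = integral_cV (fun ga : 'cV[R]_r2 =>
    (likelihood Xt Xg Sigma y th ga v * w v th)%:E).
  by apply: eq_integral_cV => ga; rewrite -mulrA.
have split_exp b d1 d2 v th : 0 < v -> gaussian b d1 d2 v th =
    b * (v `^ (- ((n%:R - r2%:R) / 2))
      * expR (- ((rss y + d1 * sqn (th - th_hat y)) / (2 * v)))
      * (N * (g * v) `^ (- (r1%:R / 2)) * inv_chi2_pdf s nu v
         * expR (- (d2 * sqn th / (2 * (g * v)))))).
  move=> v0; rewrite /gaussian.
  have -> : expR (- ((rss y + d1 * sqn (th - th_hat y)) / (2 * v))) =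
      expR (- (rss y / (2 * v))) * expR (- (d1 * sqn (th - th_hat y) / (2 * v))).
    by rewrite -expRD -opprD -mulrDl.
  by ring.
have v2 (v : R) : 0 < v -> 0 < (2 * v)^-1 by move=> ?; rewrite invr_gt0 mulr_gt0.
have NW0 v : 0 <= N * (g * v) `^ (- (r1%:R / 2)) * inv_chi2_pdf s nu v.
  by rewrite mulr_ge0 ?pdf0// mulr_ge0 ?powR_ge0// ltW.
have lower v th : 0 < v -> ((gaussian k C1 C2 v th)%:E <= inner v th)%E.
  move=> v0; have [h _] := H y th v (w v th) v0 (w0 v th v0).
  rewrite innerE; apply: le_trans h; rewrite lee_fin split_exp// wE//.
  have /andP[_ hIu] := hI (th - th_hat y); have /andP[_ hWu] := hW th.
  rewrite ler_wpM2l ?(ltW k0)//; apply: ler_pM.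
  - exact: mulr_ge0 (powR_ge0 _ _) (expR_ge0 _).
  - exact: mulr_ge0 (NW0 v) (expR_ge0 _).
  - rewrite ler_wpM2l ?powR_ge0// ler_expR lerN2 ler_pM2r ?v2//.
    by rewrite lerD2l.
  - by rewrite ler_wpM2l// ler_expR lerN2 ler_pM2r// v2// mulr_gt0.
have upper v th : 0 < v -> (inner v th <= (gaussian K c1 c2 v th)%:E)%E.
  move=> v0; have [_ h] := H y th v (w v th) v0 (w0 v th v0).
  rewrite innerE; apply: (le_trans h); rewrite lee_fin split_exp// wE//.
  have /andP[hIl _] := hI (th - th_hat y); have /andP[hWl _] := hW th.
  rewrite ler_wpM2l ?(ltW K0)//; apply: ler_pM.
  - exact: mulr_ge0 (powR_ge0 _ _) (expR_ge0 _).
  - exact: mulr_ge0 (NW0 v) (expR_ge0 _).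
  - rewrite ler_wpM2l ?powR_ge0// ler_expR lerN2 ler_pM2r ?v2//.
    by rewrite lerD2l.
  - by rewrite ler_wpM2l// ler_expR lerN2 ler_pM2r// v2// mulr_gt0.
have inner0 v th : 0 < v -> (0 <= inner v th)%E.
  move=> v0; apply: le_trans (lower v th v0).
  by rewrite lee_fin gaussian_ge0.
have /andP[L _] := HG _ _ (coef_ge0 k C1 C2 k0) (B0 _ _ C10 C20).
have /andP[_ U] := HG _ _ (coef_ge0 K c1 c2 K0) (B0 _ _ c10 c20).
have QE b c' d1 d2 : coef b * c' * Q d1 d2 =
    coef b * D d1 d2 * (c' * B d1 d2 `^ (- ((n%:R - r2%:R + nu) / 2))).
  rewrite /Q /precision_kernel addrAC -/(D d1 d2) -/(B d1 d2); ring.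
split; rewrite QE.
- apply: (le_trans L); apply: le_ge0_integral => v; rewrite /= in_itv /= andbT => v0.
    by rewrite lee_fin mulr_ge0 ?coef_ge0// mulr_ge0 ?powR_ge0 ?expR_ge0.
  rewrite -gaussianE//; apply: le_integral_cV => th.
    by rewrite lee_fin gaussian_ge0.
  exact: lower.
- apply: le_trans U; apply: le_ge0_integral => v; rewrite /= in_itv /= andbT => v0.
    by apply: integral_cV_ge0 => th; exact: inner0.
  rewrite -gaussianE//; apply: le_integral_cV => th; first exact: inner0.
  exact: upper.
Qed.

End AlternativeHypothesis.
End Marginals.

(** * Bounds on the Bayes factor *)

Section BayesFactor.
Variables (R : realType) (n r1 r2 : nat).
Variables (Xt : 'M[R]_(n, r1)) (Xg : 'M[R]_(n, r2)) (Sigma : 'M[R]_n).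
Variables (Omega : 'M[R]_r1) (s0 s1 nu0 nu1 : R) (prior : R -> R) (s2 : R).
Hypotheses (hn : (r1 + r2 < n)%N) (hSigma : posdefmx Sigma) (hOmega : posdefmx Omega)
  (hrank : \rank (row_mx Xt Xg) = (r1 + r2)%N)
  (horth : Xt^T *m invmx Sigma *m Xg = 0)
  (hs0 : 0 < s0) (hs1 : 0 < s1) (hnu0 : 0 <= nu0) (hnu1 : 0 <= nu1)
  (hprior : is_pos_density prior) (hs2 : 0 < s2).

Local Notation mu := (@lebesgue_measure R).
Local Notation pos := (`]0%R, +oo[%classic : set R).
Local Notation th_hat := (theta_hat Xt Sigma).
Local Notation rss := (s2_resid Xt Xg Sigma).
Local Notation B10 := (bayes_factor Xt Xg Sigma Omega s0 nu0 s1 nu1 prior).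
Local Notation df nu := ((n%:R - r2%:R + nu) / 2).

Let r2n : (r2 < n)%N. Proof. exact: leq_ltn_trans (leq_addl _ _) hn. Qed.

(** From here on the residual sum of squares is fixed at [s2], so that only the
    squared norm of the estimate of theta varies with the data. *)
Lemma marginal0_bounds : exists l u : R, [/\ 0 < l, 0 < u &
  forall y, rss y = s2 -> let E := (1 + sqn (th_hat y)) `^ (- df nu0) in
    ((l * E)%:E <= marginal0 Xt Xg Sigma s0 nu0 y)%E /\
    (marginal0 Xt Xg Sigma s0 nu0 y <= (u * E)%:E)%E].
Proof.
have [k [K [k0 K0 H]]] := marginal0_kernel_bounds hSigma hrank horth hs0 hnu0 r2n.
have [c [C [c0 C0 hI]]] := posdef_equiv_sqn (posdef_I hSigma hrank).
have p0 := df_gt0 hnu0 r2n.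
set D := s2 + nu0 * s0 ^+ 2.
have D0 : 0 < D by rewrite ltr_pwDl// mulr_ge0// sqr_ge0.
set a := Num.min D c; set b := Num.max D C.
have a0 : 0 < a by rewrite lt_min D0.
have b0 : 0 < b by rewrite lt_max D0.
exists (k * b `^ (- df nu0)), (K * a `^ (- df nu0)).
split; rewrite ?mulr_gt0 ?powR_gt0// => y ry E.
have := H y; rewrite ry => /(_ hs2); rewrite addrAC -/D => -[L U].
have t0 := sqn_ge0 (th_hat y).
have T0 : 0 < 1 + sqn (th_hat y) by rewrite ltr_pwDl.
have /andP[hl hu] := hI (th_hat y).
set Y := D + _ in L U.
have Y0 : 0 < Y by rewrite ltr_pwDl//; apply: le_trans hl; rewrite mulr_ge0// ltW.
have [yl yu] := @powRN_sandwich _ (df nu0) a b _ Y (ltW p0) a0 T0 b0.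
split; [apply: le_trans L|apply: (le_trans U)]; rewrite lee_fin -mulrA ler_wpM2l//.
- exact: ltW.
- apply: yu => //; have /andP[_] := affine_sandwich D C t0.
  by apply: le_trans; rewrite lerD2l.
- exact: ltW.
- apply: yl; have /andP[+ _] := affine_sandwich D c t0.
  by move=> /le_trans; apply; rewrite lerD2l.
Qed.

Lemma marginal1_bounds : exists l u : R, [/\ 0 < l, 0 < u &
  forall y g, rss y = s2 -> 0 < g ->
    let m1 := marginal1_given Xt Xg Sigma Omega s1 nu1 g y in
    let t := sqn (th_hat y) in
    let E := (g + 1) `^ ((n%:R - r1%:R - r2%:R + nu1) / 2) * (1 + t) `^ (- df nu1) in
    [/\ (0 <= m1)%E, (m1 <= (u * E)%:E)%E & g <= t -> ((l * E)%:E <= m1)%E]].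
Proof.
have [k [K [c1 [c2 [C1 [C2 [[k0 K0 c10 c20] C10 C20 H]]]]]]] :=
  marginal1_kernel_bounds hSigma hrank horth hOmega hs1 hnu1 r2n.
have p0 := df_gt0 hnu1 r2n.
have D0 : 0 < s2 + nu1 * s1 ^+ 2 by rewrite ltr_pwDl// mulr_ge0// sqr_ge0.
have h0 : 0 <= r1%:R / 2 :> R by [].
have [lu [u [lu0 u0 HU]]] := precision_kernel_sandwich D0 c10 c20 h0 (ltW p0).
have [l [ul [l0 ul0 HL]]] := precision_kernel_sandwich D0 C10 C20 h0 (ltW p0).
exists (k * l), (K * u); split; rewrite ?mulr_gt0// => y g ry g0 m1 t E.
have EE : E = (g + 1) `^ (df nu1 - r1%:R / 2) * (1 + t) `^ (- df nu1).
  by rewrite /E; congr (_ `^ _ * _); field.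
have := H y g; rewrite ry => /(_ hs2 g0); rewrite -/m1 => -[L U].
have t0 := sqn_ge0 (th_hat y).
have [hu _] := HU _ _ g0 t0; have [_ hl] := HL _ _ g0 t0.
split.
- by apply: le_trans L; rewrite lee_fin !mulr_ge0 ?powR_ge0// ltW.
- by apply: (le_trans U); rewrite lee_fin EE -[leRHS]mulrA ler_wpM2l ?(ltW K0).
- by move=> gt; apply: le_trans L; rewrite lee_fin EE -[leLHS]mulrA ler_wpM2l ?(ltW k0) ?hl.
Qed.

Let moment_fun g := (g + 1) `^ ((n%:R - r1%:R - r2%:R + nu1) / 2) * prior g.
Let moment := (\int[mu]_(g in `]0%R, +oo[) (moment_fun g)%:E)%E.
Let truncated G := (\int[mu]_(g in `]0%R, G]) (moment_fun g)%:E)%E.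

Let prior_ge0 g : 0 < g -> 0 <= prior g. Proof. by case: hprior => _ + _; apply. Qed.

Let moment_fun_ge0 g : 0 < g -> 0 <= moment_fun g.
Proof. by move=> g0; rewrite mulr_ge0 ?powR_ge0 ?prior_ge0. Qed.

Let measurable_moment_fun : measurable_fun pos moment_fun.
Proof.
have [mp _ _] := hprior; apply: measurable_funM => //.
apply: (@measurableT_comp _ _ _ _ _ _ (@powR R ^~ _)) => //.
exact: measurable_funD.
Qed.

Let moment_ge0 : (0 <= moment)%E.
Proof.
apply: integral_ge0 => g; rewrite /= in_itv /= andbT => g0.
by rewrite lee_fin moment_fun_ge0.
Qed.

Let marginal1_ge0 y : rss y = s2 -> (0 <= marginal1 Xt Xg Sigma Omega s1 nu1 prior y)%E.
Proof.
move=> ry; have [l [u [l0 u0 H]]] := marginal1_bounds.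
apply: integral_ge0 => g; rewrite /= in_itv /= andbT => g0.
have [m10 _ _] := H y g ry g0.
by rewrite mule_ge0// lee_fin prior_ge0.
Qed.

Let delta := (nu0 - nu1) / 2.

Let deltaE y : (1 + sqn (th_hat y)) `^ delta =
  (1 + sqn (th_hat y)) `^ (- df nu1) / (1 + sqn (th_hat y)) `^ (- df nu0).
Proof.
have T0 : 0 < 1 + sqn (th_hat y) by rewrite ltr_pwDl// sqn_ge0.
rewrite [in RHS]powRN [X in _ / X]powRN invrK -powRN -powRD ?(gt_eqF T0) ?implybT//.
by congr (_ `^ _); rewrite /delta; field.
Qed.

Lemma bayes_factor_le : exists2 C : R, 0 < C & forall y, rss y = s2 ->
  (B10 y <= (C * (1 + sqn (th_hat y)) `^ delta)%:E * moment)%E.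
Proof.
have [l0 [u0 [l00 u00 H0]]] := marginal0_bounds.
have [l1 [u1 [l10 u10 H1]]] := marginal1_bounds.
exists (u1 / l0); first by rewrite divr_gt0.
move=> y ry; have [L _] := H0 y ry.
have T0 : 0 < 1 + sqn (th_hat y) by rewrite ltr_pwDl// sqn_ge0.
set T := 1 + _ in L T0 *.
have M1 : (marginal1 Xt Xg Sigma Omega s1 nu1 prior y <=
    (u1 * T `^ (- df nu1))%:E * moment)%E.
  rewrite /moment -ge0_integralZl_EFin//; last 3 first.
  - by move=> g; rewrite /= in_itv /= andbT => g0; rewrite lee_fin moment_fun_ge0.
  - exact/measurable_EFinP.
  - by rewrite mulr_ge0 ?powR_ge0 ?(ltW u10).
  apply: le_ge0_integral => g; rewrite /= in_itv /= andbT => g0;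
    have [m10 m1u _] := H1 y g ry g0.
    by rewrite mule_ge0// lee_fin prior_ge0.
  apply: le_trans (lee_wpmul2r _ m1u) _; first by rewrite lee_fin prior_ge0.
  by rewrite -!EFinM lee_fin le_eqVlt; apply/orP; left; apply/eqP;
    rewrite /moment_fun -/T; ring.
have L0 : 0 < l0 * T `^ (- df nu0) by rewrite mulr_gt0 ?powR_gt0.
have Vle : ((marginal0 Xt Xg Sigma s0 nu0 y)^-1 <= ((l0 * T `^ (- df nu0))^-1)%:E)%E.
  have -> : ((l0 * T `^ (- df nu0))^-1)%:E = ((l0 * T `^ (- df nu0))%:E^-1)%E.
    by rewrite inver gt_eqF.
  by rewrite lee_pV2// inE ?lee_fin ?(ltW L0)// (le_trans _ L)// lee_fin ltW.
apply: (@le_trans _ _ ((u1 * T `^ (- df nu1))%:E * moment *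
    ((l0 * T `^ (- df nu0))^-1)%:E)%E).
  apply: lee_pmul => //; first exact: marginal1_ge0.
  by rewrite inve_ge0 (le_trans _ L)// lee_fin ltW.
rewrite muleAC -EFinM deltaE -/T; rewrite le_eqVlt; apply/orP; left; apply/eqP.
by congr (_%:E * _)%E; rewrite invfM; ring.
Qed.

(** The prior mass beyond [G] is discarded: below [G <= t] the lower bound for the
    alternative has the same shape as the upper one. *)
Lemma bayes_factor_ge : exists2 c : R, 0 < c & forall y G, rss y = s2 ->
  0 < G -> G <= sqn (th_hat y) ->
  ((c * (1 + sqn (th_hat y)) `^ delta)%:E * truncated G <= B10 y)%E.
Proof.
have [l0 [u0 [l00 u00 H0]]] := marginal0_bounds.
have [l1 [u1 [l10 u10 H1]]] := marginal1_bounds.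
exists (l1 / u0); first by rewrite divr_gt0.
move=> y G ry G0 Gt; have [L U] := H0 y ry.
have T0 : 0 < 1 + sqn (th_hat y) by rewrite ltr_pwDl// sqn_ge0.
set T := 1 + _ in L U T0 *.
have subG : `]0%R, G]%classic `<=` pos.
  by move=> x; rewrite /= !in_itv /= andbT => /andP[].
have trunc0 : (0 <= truncated G)%E.
  apply: integral_ge0 => g /subG; rewrite /= in_itv /= andbT => g0.
  by rewrite lee_fin moment_fun_ge0.
have M1 : ((l1 * T `^ (- df nu1))%:E * truncated G <=
    marginal1 Xt Xg Sigma Omega s1 nu1 prior y)%E.
  rewrite /truncated -ge0_integralZl_EFin//; last 3 first.
  - move=> g /subG; rewrite /= in_itv /= andbT => g0.
    by rewrite lee_fin moment_fun_ge0.
  - by apply/measurable_EFinP; apply: measurable_funS measurable_moment_fun.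
  - by rewrite mulr_ge0 ?powR_ge0 ?(ltW l10).
  rewrite -(setIidr subG) integral_mkcondr.
  apply: le_ge0_integral => g; rewrite /= in_itv /= andbT => g0;
    have [m10 _ m1l] := H1 y g ry g0.
    apply: erestrict_ge0 => g' /subG; rewrite /= in_itv /= andbT => g'0.
    by rewrite mule_ge0// lee_fin ?moment_fun_ge0// mulr_ge0 ?powR_ge0 ?(ltW l10).
  rewrite patchE; case: ifPn => [|_]; last first.
    by rewrite mule_ge0// lee_fin prior_ge0.
  rewrite inE /= in_itv /= => /andP[_ gG].
  apply: le_trans (lee_wpmul2r _ (m1l (le_trans gG Gt))); last first.
    by rewrite lee_fin prior_ge0.
  by rewrite -!EFinM lee_fin le_eqVlt; apply/orP; left; apply/eqP;
    rewrite /moment_fun -/T; ring.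
have U0 : 0 < u0 * T `^ (- df nu0) by rewrite mulr_gt0 ?powR_gt0.
have L0 : (0 <= marginal0 Xt Xg Sigma s0 nu0 y)%E.
  by apply: le_trans L; rewrite lee_fin ltW// mulr_gt0 ?powR_gt0.
have Vge : (((u0 * T `^ (- df nu0))^-1)%:E <= (marginal0 Xt Xg Sigma s0 nu0 y)^-1)%E.
  have -> : ((u0 * T `^ (- df nu0))^-1)%:E = ((u0 * T `^ (- df nu0))%:E^-1)%E.
    by rewrite inver gt_eqF.
  by rewrite lee_pV2// inE lee_fin ltW.
apply: (@le_trans _ _ ((l1 * T `^ (- df nu1))%:E * truncated G *
    ((u0 * T `^ (- df nu0))^-1)%:E)%E).
  rewrite muleAC -EFinM deltaE -/T; rewrite le_eqVlt; apply/orP; left; apply/eqP.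
  by congr (_%:E * _)%E; rewrite invfM; ring.
apply: lee_pmul => //.
- by rewrite mule_ge0// lee_fin mulr_ge0 ?powR_ge0 ?(ltW l10).
- by rewrite lee_fin invr_ge0 ltW.
Qed.

(** The data have estimates [i *: e] for a unit vector [e], which needs [0 < r1]; the
    factor [(1 + t) `^ delta] of the upper bound is at most [1]. *)
Lemma inconsistent_of_finite_moment : (0 < r1)%N -> nu0 <= nu1 -> moment != +oo%E ->
  information_inconsistent Xt Xg Sigma s2 B10.
Proof.
move=> r10 nu01 mfin; have [C C0 HC] := bayes_factor_le.
have momE : moment = (fine moment)%:E.
  by rewrite fineK// ge0_fin_numE ?moment_ge0// ltey.
pose a (i : nat) : 'cV[R]_r1 := i%:R *: delta_mx (Ordinal r10) 0.
have /choice[y Hy] i : exists y, th_hat y = a i /\ rss y = s2.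
  have [y ya yr] := data_with_estimate hSigma hrank horth (a i) hn hs2.
  by exists y.
exists y, (C * fine moment + 1); split.
- by move=> i; have [] := Hy i.
- apply/cvgryPge => A; near=> i; have [-> _] := Hy i.
  have -> : enorm (a i) = i%:R.
    rewrite /enorm -/(sqn _) sqnE (bigD1 (Ordinal r10))//= big1 => [|j jr].
      by rewrite !mxE !eqxx mulr1 addr0 sqrtr_sqr ger0_norm.
    by rewrite !mxE (negbTE jr) mulr0 expr0n.
  by near: i; exact: nbhs_infty_ger.
- move=> i; have [_ ri] := Hy i; apply: le_lt_trans (HC _ ri) _.
  rewrite momE -EFinM lte_fin; apply: (@le_lt_trans _ _ (C * fine moment)).
    rewrite ler_wpM2r ?fine_ge0 ?moment_ge0// ler_piMr ?(ltW C0)//.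
    rewrite -[leRHS](powRr0 (1 + sqn (th_hat (y i)))) ler_powR//.
      by rewrite lerDl sqn_ge0.
    by rewrite /delta pmulr_lle0 ?invr_gt0// subr_le0.
  by rewrite ltrDl.
Unshelve. all: by end_near. Qed.

(** A bounded Bayes factor along data with diverging estimates bounds
    [(1 + t) `^ delta * truncated G] for every [G] and arbitrarily large [t]. *)
Lemma truncated_moment_bound : information_inconsistent Xt Xg Sigma s2 B10 ->
  exists2 K : R, 0 < K & forall G T, 0 < G -> exists2 t, T <= t &
    (((1 + t) `^ delta)%:E * truncated G <= K%:E)%E.
Proof.
move=> [y [Bs [ry ynorm yB]]]; have [c c0 Hc] := bayes_factor_ge.
exists (c^-1 * (`|Bs| + 1)); first by rewrite mulr_gt0 ?invr_gt0// ltr_wpDl.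
move=> G T G0; have /cvgryPge /(_ (1 + `|G| + `|T|)) := ynorm.
case=> i _ /(_ i (leqnn i)) /= hi.
have tge : 1 + `|G| + `|T| <= sqn (th_hat (y i)).
  rewrite -sqr_enorm expr2; apply: (le_trans hi); rewrite ler_peMl//.
    by rewrite sqrtr_ge0.
  by apply: le_trans hi; rewrite -addrA lerDl addr_ge0.
exists (sqn (th_hat (y i))).
  by apply: le_trans tge; rewrite (le_trans (ler_norm T))// lerDr addr_ge0.
have Gt : G <= sqn (th_hat (y i)).
  apply: le_trans tge; rewrite (le_trans (ler_norm G))//.
  by rewrite addrAC lerDr addr_ge0.
have := Hc _ _ (ry i) G0 Gt => /le_trans /(_ (ltW (yB i))) h.
have : (c^-1%:E * ((c * (1 + sqn (th_hat (y i))) `^ delta)%:E * truncated G) <=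
    c^-1%:E * (`|Bs| + 1)%:E)%E.
  apply: lee_wpmul2l; first by rewrite lee_fin invr_ge0 ltW.
  by apply: (le_trans h); rewrite lee_fin ler_wpDr// ler_norm.
by rewrite muleA -!EFinM mulKf// gt_eqF.
Qed.

Lemma consistent_of_infinite_moment : nu0 = nu1 -> moment = +oo%E ->
  information_consistent Xt Xg Sigma s2 B10.
Proof.
move=> nuE minf /truncated_moment_bound[K K0 HK].
have : (moment <= K%:E)%E.
  apply: integral_pos_le_of_itvoc => // G G0; have [t _] := HK G 0 G0.
  by rewrite /delta nuE subrr mul0r powRr0 mul1e.
by rewrite minf leye_eq.
Qed.

(** The truncated moments would all be at most [2^-1], hence so would the moment; but
    its exponent is nonnegative, so it is at least the mass [1] of the prior. *)
Lemma consistent_of_smaller_df : nu1 < nu0 -> information_consistent Xt Xg Sigma s2 B10.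
Proof.
move=> nu10 /truncated_moment_bound[K K0 HK].
have d0 : 0 < delta by rewrite divr_gt0// subr_gt0.
have : (moment <= 2^-1%:E)%E.
  apply: integral_pos_le_of_itvoc => // G G0.
  (* Beyond this threshold [(1 + t) `^ delta] is at least [2 * K]. *)
  have [t tK H] := HK G ((2 * K) `^ delta^-1) G0.
  have K20 : 0 < 2 * K by rewrite mulr_gt0.
  have Kt : 2 * K <= (1 + t) `^ delta.
    have -> : 2 * K = ((2 * K) `^ delta^-1) `^ delta.
      by rewrite -powRrM mulVf ?powRr1 ?(ltW K20)// gt_eqF.
    have P0 := powR_ge0 (2 * K) delta^-1.
    have t0 := le_trans P0 tK.
    apply: ge0_ler_powR; rewrite ?nnegrE ?(ltW d0) ?addr_ge0//.
    by apply: (le_trans tK); rewrite lerDr.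
  have tr0 : (0 <= truncated G)%E.
    apply: integral_ge0 => g; rewrite /= in_itv /= => /andP[g0 _].
    by rewrite lee_fin moment_fun_ge0.
  have : ((2 * K)%:E * truncated G <= K%:E)%E.
    by apply: le_trans H; apply: lee_wpmul2r.
  rewrite -(@lee_pmul2l _ (2 * K)^-1%:E) ?lte_fin ?invr_gt0//.
  rewrite muleA -!EFinM mulVf ?gt_eqF// mul1e => /le_trans; apply.
  by rewrite lee_fin invfM -mulrA mulVf ?mulr1// gt_eqF.
apply/negP; rewrite -ltNge; have [_ _ prior1] := hprior.
apply: (@lt_le_trans _ _ 1%E); first by rewrite lte_fin invf_lt1// ltr1n.
rewrite -prior1; apply: le_ge0_integral => g; rewrite /= in_itv /= andbT => g0.
  by rewrite lee_fin prior_ge0.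
rewrite lee_fin ler_peMl ?prior_ge0//.
rewrite -[leLHS](powRr0 (g + 1)) ler_powR ?lerDr ?(ltW g0)//.
rewrite divr_ge0// addr_ge0// -addrA -opprD -natrD subr_ge0 ler_nat.
exact: ltnW.
Qed.

End BayesFactor.

Theorem lemma2 (R : realType) (n r1 r2 : nat)
    (hr1 : (1 <= r1)%N) (hn : (r1 + r2 < n)%N)
    (Xt : 'M[R]_(n, r1)) (Xg : 'M[R]_(n, r2))
    (Sigma : 'M[R]_n) (Omega : 'M[R]_r1)
    (hSigma : posdefmx Sigma) (hOmega : posdefmx Omega)
    (hrank : \rank (row_mx Xt Xg) = (r1 + r2)%N)
    (horth : Xt^T *m invmx Sigma *m Xg = 0)
    (s0 s1 nu0 nu1 : R)
    (hs0 : 0 < s0) (hs1 : 0 < s1) (hnu0 : 0 <= nu0) (hnu1 : 0 <= nu1)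
    (prior : R -> R) (hprior : is_pos_density prior)
    (s2 : R) (hs2 : 0 < s2) :
  let B10 := bayes_factor Xt Xg Sigma Omega s0 nu0 s1 nu1 prior in
  let consistent := information_consistent Xt Xg Sigma s2 B10 in
  let moment_infinite :=
    (\int[lebesgue_measure]_(g in `]0%R, +oo[)
       (((g + 1) `^ ((n%:R - r1%:R - r2%:R + nu1) / 2) * prior g)%:E)
     = +oo)%E in
  [/\ nu1 < nu0 -> consistent,
      nu0 = nu1 -> (consistent <-> moment_infinite)
    & nu0 < nu1 -> (consistent -> moment_infinite)].
Proof.
move=> B10 consistent moment_infinite.
have necessary : nu0 <= nu1 -> consistent -> moment_infinite.
  move=> nu01 cons; apply/eqP; apply: contra_notT cons => mfin.
  exact: inconsistent_of_finite_moment.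
split.
- by move=> ?; exact: consistent_of_smaller_df.
- move=> nuE; split; first by apply: necessary; rewrite nuE.
  exact: consistent_of_infinite_moment.
- by move=> /ltW /necessary.
Qed.
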